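(* Let $\mathcal{F}$ be a transitive projective Fraisse category with projective Fraisse limit $\mathbb{F}$, let $F=\mathbb{F}/R^{\mathbb{F}}$ be the quotient space, and let $\Phi:\mathrm{Aut}(\mathbb{F})\to\mathrm{Homeo}(F)$ be the map induced by the quotient map. Then every $A\in\mathcal{F}$ has finite approximate Ramsey degree in $\mathcal{F}$ if and only if $\overline{\Phi[\mathrm{Aut}(\mathbb{F})]}$, with the topology inherited as a closed subgroup of $\mathrm{Homeo}(F)$, has metrizable universal minimal flow.
   Context: All spaces are Hausdorff; $\mathbb{N}=\{0,1,2,\ldots\}$. **Structures and morphisms.** A graph $(A,R^A)$ is a set with a reflexive symmetric binary relation. Let $\mathcal{L}$ be a language containing a special binary relation symbol $R$. A morphism $f:B\to A$ of $\mathcal{L}$-structures preserves relations ($S^B(b_1,\ldots,b_m)\Rightarrow S^A(f(b_1),\ldots,f(b_m))$) and commutes with function symbols. It is a surjective morphism if it is surjective as a map and whenever $S^A(a_1,\ldots,a_m)$ for a relation symbol $S$, there are $b_i$ with $f(b_i)=a_i$ and $S^B(b_1,\ldots,b_m)$. **Projective Fraisse category.** A category $\mathcal{F}$ of $\mathcal{L}$-structures and surjective morphisms such that: (i) for each $A\in\mathcal{F}$, $(A,R^A)$ is a finite graph; (ii) there are countably many structures in $\mathcal{F}$ up to isomorphism; (iii) for any $A,B\in\mathcal{F}$ there are $C\in\mathcal{F}$ and morphisms $C\to A$, $C\to B$ in $\mathcal{F}$; (iv) for any morphisms $f:B\to A$, $g:C\to A$ in $\mathcal{F}$ there are $D\in\mathcal{F}$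 and morphisms $f':D\to B$, $g':D\to C$ in $\mathcal{F}$ with $f\circ f'=g\circ g'$. $\mathrm{Epi}(B,A)$ is the set of all morphisms $B\to A$ in $\mathcal{F}$. **Limits.** $\mathcal{F}^\omega$ has as objects inverse limits $\mathbb{L}=\varprojlim(A_n,f_n^{n+1})_{n\in\mathbb{N}}$ with $A_n\in\mathcal{F}$ and $f_n^{n+1}:A_{n+1}\to A_n$ in $\mathcal{F}$; $\pi_n^{\mathbb{L}}:\mathbb{L}\to A_n$ are the projections. A morphism $h:\mathbb{L}=\varprojlim(A_n,f_n^{n+1})\to\mathbb{M}=\varprojlim(B_n,g_n^{n+1})$ is a map for which there are $i_0<i_1<\cdots$ and morphisms $h_n:A_{i_n}\to B_n$ in $\mathcal{F}$ with $\pi_n^{\mathbb{M}}\circ h=h_n\circ\pi_{i_n}^{\mathbb{L}}$ for all $n$; it is an isomorphism if it is bijective and $h^{-1}$ is a morphism. $\mathcal{F}$ is viewed inside $\mathcal{F}^\omega$ via constant sequences. Each $\mathbb{L}$ is topologized as a subspace of $\prod_n A_n$ (each $A_n$ discrete) and carries the $\mathcal{L}$-structure defined coordinatewise; in particular $xR^{\mathbb{L}}y$ iff $\pi_n^{\mathbb L}(x)R^{A_n}\pi_n^{\mathbb L}(y)$ for all $n$. The projective Fraisse limit of $\mathcal{F}$ is the unique up to isomorphism $\mathbb{F}\in\mathcal{F}^\omega$ such that (i) for each $A\in\mathcal{F}$ there is a morphism $\mathbb{F}\to A$; (ii) for all $A,B\in\mathcal{F}$ and morphisms $f:\mathbb{F}\to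 A$, $g:B\to A$, there is a morphism $h:\mathbb{F}\to B$ with $g\circ h=f$. $\mathcal{F}$ is transitive if $R^{\mathbb{F}}$ is a transitive relation; then $R^{\mathbb{F}}$ is a compact equivalence relation and $F=\mathbb{F}/R^{\mathbb{F}}$ with the quotient topology is compact metrizable; $q:\mathbb{F}\to F$ is the quotient map. **Groups.** $\mathrm{Aut}(\mathbb{F})$ is the group of isomorphisms $\mathbb{F}\to\mathbb{F}$ in $\mathcal{F}^\omega$. $\mathrm{Homeo}(F)$ is the group of homeomorphisms of $F$ with the uniform convergence topology. $\Phi$ is given by $\Phi(f)(q(x))=q(f(x))$. **Approximate Ramsey degree.** For $A\in\mathcal{F}$, $d_A$ is the graph metric: $d_A(a,a)=0$, and for $a\ne b$, $d_A(a,b)$ is the least $l$ such that there are $a=a_0,a_1,\ldots,a_l=b$ with $a_iR^Aa_{i+1}$ for $i<l$ ($\infty$ if there is none). For $f,g\in\mathrm{Epi}(B,A)$, $d_{\mathrm{Epi}(B,A)}(f,g)=\sup_{b\in B}d_A(f(b),g(b))$. For $X\subseteq\mathrm{Epi}(C,A)$, $[X]_1=\{g\in\mathrm{Epi}(C,A):\exists f\in X\ d_{\mathrm{Epi}(C,A)}(f,g)\le1\}$. $A\in\mathcal{F}$ has approximate Ramsey degree $\le k$ if for all $B\in\mathcal{F}$ and $d\in\mathbb{N}$ there is $C\in\mathcal{F}$ such that for every $\chi:\mathrm{Epi}(C,A)\to\{1,\ldots,d\}$ there are $f\in\mathrm{Epi}(C,B)$ and $I\subseteq\{1,\ldots,d\}$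 with $|I|\le k$ and $\mathrm{Epi}(B,A)\circ f\subseteq[\chi^{-1}[I]]_1$, where $\mathrm{Epi}(B,A)\circ f=\{h\circ f:h\in\mathrm{Epi}(B,A)\}$. The approximate Ramsey degree of $A$ is the least $k\in\mathbb{N}$ such that $A$ has approximate Ramsey degree $\le k$; it is infinite if no such $k$ exists. **Dynamics.** A $G$-flow is a compact space with a continuous action of the topological group $G$; it is minimal if every orbit is dense. The universal minimal flow of $G$ is the unique up to isomorphism minimal $G$-flow that admits a continuous equivariant surjection onto every minimal $G$-flow. *)

(* Defs.v *)
From HB Require Import structures.
From mathcomp Require Import all_boot all_order all_algebra generic_quotient.
From mathcomp Require Import all_classical all_reals all_analysis.

Set Implicit Arguments.
Unset Strict Implicit.
Unset Printing Implicit Defensive.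

Import Order.TTheory GRing.Theory Num.Theory.

Local Open Scope classical_set_scope.
Local Open Scope ring_scope.

Record language := Language {
  rel_symb : Type;
  rel_arity : rel_symb -> nat;
  fun_symb : Type;
  fun_arity : fun_symb -> nat;
  edge_symb : rel_symb;
  edge_symb_binary : rel_arity edge_symb = 2%N }.

Record structure (L : language) := Structure {
  carrier :> choiceType;
  rel_interp : forall S : rel_symb L, ('I_(rel_arity S) -> carrier) -> Prop;
  fun_interp : forall s : fun_symb L, ('I_(fun_arity s) -> carrier) -> carrier }.

Section Structures.
Context {L : language}.

(* The arity of [edge_symb] is only propositionally 2; reading the pair (a, b)
   off the index value avoids a cast. *)
Definition pair_args {A : Type} {n : nat} (a b : A) : 'I_n -> A :=
  fun i => if val i == 0%N then a else b.

Definition edge (A : structure L) (a b : A) : Prop :=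
  rel_interp (S := edge_symb L) (pair_args a b).

Definition finite_graph (A : structure L) : Prop :=
  [/\ finite_set [set: A], (forall a : A, edge a a)
    & (forall a b : A, edge a b -> edge b a)].

Definition is_morphism (B A : structure L) (f : B -> A) : Prop :=
  (forall (S : rel_symb L) (b : 'I_(rel_arity S) -> B),
     rel_interp b -> rel_interp (f \o b)) /\
  (forall (s : fun_symb L) (b : 'I_(fun_arity s) -> B),
     f (fun_interp b) = fun_interp (f \o b)).

Definition is_surj_morphism (B A : structure L) (f : B -> A) : Prop :=
  [/\ is_morphism f,
      (forall a : A, exists b : B, f b = a)
    & (forall (S : rel_symb L) (a : 'I_(rel_arity S) -> A), rel_interp a ->
         exists2 b : 'I_(rel_arity S) -> B, f \o b = a & rel_interp b)].

Lemma morphism_edge (B A : structure L) (f : B -> A) (b b' : B) :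
  is_morphism f -> edge b b' -> edge (f b) (f b').
Proof.
move=> [fS _] /fS; rewrite /edge; congr rel_interp.
by apply/funext => i; rewrite /pair_args /=; case: ifP.
Qed.

End Structures.

Record struct_category (L : language) := StructCategory {
  obj : structure L -> Prop;
  mor : forall B A : structure L, (B -> A) -> Prop;
  mor_obj : forall (B A : structure L) (f : B -> A),
    mor f -> obj B /\ obj A;
  mor_surj : forall (B A : structure L) (f : B -> A),
    mor f -> is_surj_morphism f;
  mor_id : forall A : structure L, obj A -> mor (fun a : A => a);
  mor_comp : forall (C B A : structure L) (g : C -> B) (f : B -> A),
    mor g -> mor f -> mor (f \o g) }.

(* Isomorphism means isomorphism in the category: the inverse bijection is
   required to be a morphism of the category. *)
Definition iso_in {L : language} (F : struct_category L) (A B : structure L) :=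
  exists (f : A -> B) (g : B -> A),
    [/\ mor F f, mor F g, cancel f g & cancel g f].

Record proj_fraisse (L : language) := ProjFraisse {
  pf_cat :> struct_category L;
  pf_finite_graph : forall A : structure L, obj pf_cat A -> finite_graph A;
  pf_countable : exists E : nat -> structure L,
    forall A, obj pf_cat A -> exists n, iso_in pf_cat A (E n);
  pf_joint : forall A B : structure L, obj pf_cat A -> obj pf_cat B ->
    exists (C : structure L) (f : C -> A) (g : C -> B),
      mor pf_cat f /\ mor pf_cat g;
  pf_amalgamation : forall (A B C : structure L) (f : B -> A) (g : C -> A),
    mor pf_cat f -> mor pf_cat g ->
    exists (D : structure L) (f' : D -> B) (g' : D -> C),
      [/\ mor pf_cat f', mor pf_cat g' & f \o f' = g \o g'] }.

Record omega_obj {L : language} (F : struct_category L) := OmegaObj {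
  level : nat -> structure L;
  bond : forall n, level n.+1 -> level n;
  level_obj : forall n, obj F (level n);
  bond_mor : forall n, mor F (@bond n) }.

Arguments bond {L F} o n : rename.

Section OmegaCategory.
Context {L : language} {F : struct_category L}.
Implicit Types X Y Z : omega_obj F.

Definition threads X :
    set (prod_topology (fun n => discrete_topology (level X n))) :=
  [set x | forall n, bond X n (x n.+1) = x n].

(* The subspace topology inherited from the product of discrete spaces. *)
Definition omega_lim X : topologicalType := set_type (@threads X).

Definition lproj X (n : nat) (x : omega_lim X) : level X n := set_val x n.

Lemma lproj_bond X n (x : omega_lim X) : bond X n (lproj n.+1 x) = lproj n x.
Proof. by have := set_valP x; apply. Qed.

Lemma lproj_inj X (x y : omega_lim X) :
  (forall n, lproj n x = lproj n y) -> x = y.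
Proof. by move=> xy; apply/val_inj/functional_extensionality_dep => n; exact: xy. Qed.

Definition thread X (x : forall n, level X n)
    (xP : forall n, bond X n (x n.+1) = x n) : omega_lim X :=
  SigSub (mem_set xP : x \in @threads X).

Lemma lproj_thread X x xP n : lproj n (@thread X x xP) = x n.
Proof. by []. Qed.

Lemma lim_fun_subproof X (s : fun_symb L)
    (b : 'I_(fun_arity s) -> omega_lim X) n :
  bond X n (fun_interp (@lproj X n.+1 \o b)) = fun_interp (@lproj X n \o b).
Proof.
have [[_ ->] _ _] := mor_surj (bond_mor X n).
by congr fun_interp; apply/funext => i /=; rewrite lproj_bond.
Qed.

Definition lim_structure X : structure L := {|
  carrier := omega_lim X;
  rel_interp := fun S b => forall n, rel_interp (@lproj X n \o b);
  fun_interp := fun s b =>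
    thread (x := fun n => fun_interp (@lproj X n \o b))
           (lim_fun_subproof b) |}.

Definition ledge X (x y : omega_lim X) : Prop := edge (A := lim_structure X) x y.

Lemma ledgeE X (x y : omega_lim X) :
  ledge x y <-> forall n, edge (lproj n x) (lproj n y).
Proof.
have E n : @lproj X n \o pair_args x y =
    pair_args (lproj n x) (lproj n y) :> ('I_(rel_arity (edge_symb L)) -> _).
  by apply/funext => i; rewrite /pair_args /=; case: ifP.
by rewrite /ledge /edge /=; split=> xy n; have := xy n; rewrite E.
Qed.

Definition is_omega_mor X Y (h : omega_lim X -> omega_lim Y) : Prop :=
  exists (i : nat -> nat) (phi : forall n, level X (i n) -> level Y n),
    [/\ {homo i : m n / (m < n)%N},
        (forall n, mor F (phi n))
      & (forall n, @lproj Y n \o h = phi n \o @lproj X (i n))].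

Lemma omega_mor_id X : is_omega_mor (fun x : omega_lim X => x).
Proof.
by exists id, (fun n a => a); split=> // n; apply: mor_id; apply: level_obj.
Qed.

Lemma omega_mor_comp X Y Z (k : omega_lim X -> omega_lim Y)
    (h : omega_lim Y -> omega_lim Z) :
  is_omega_mor k -> is_omega_mor h -> is_omega_mor (h \o k).
Proof.
move=> [i [phi [iS phiM phiE]]] [j [psi [jS psiM psiE]]].
exists (i \o j), (fun n => psi n \o phi (j n)); split.
- by move=> m n /jS /iS.
- by move=> n; apply: mor_comp; [exact: phiM | exact: psiM].
- by move=> n; rewrite compA psiE -compA phiE.
Qed.

Lemma omega_mor_ledge X Y (h : omega_lim X -> omega_lim Y) x y :
  is_omega_mor h -> ledge x y -> ledge (h x) (h y).
Proof.
move=> [i [phi [_ phiM phiE]]] /ledgeE xy; apply/ledgeE => n.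
have E z : lproj n (h z) = phi n (lproj (i n) z) by have /= := congr1 (@^~ z) (phiE n).
by rewrite !E; apply: morphism_edge => //; have [] := mor_surj (phiM n).
Qed.

(* The embedding of the category into its inverse limits, on objects
   ([const_obj]) and on morphisms ([const_map]). *)
Definition const_obj (A : structure L) (oA : obj F A) : omega_obj F := {|
  level := fun=> A;
  bond := fun _ a => a;
  level_obj := fun=> oA;
  bond_mor := fun=> mor_id oA |}.

Lemma const_map_subproof (B A : structure L) (oB : obj F B) (g : B -> A)
    (x : omega_lim (const_obj oB)) n : g (lproj n.+1 x) = g (lproj n x).
Proof. by rewrite -(lproj_bond n x). Qed.

Definition const_map (B A : structure L) (oB : obj F B) (oA : obj F A)
    (g : B -> A) (x : omega_lim (const_obj oB)) : omega_lim (const_obj oA) :=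
  @thread (const_obj oA) (fun n => g (lproj n x)) (const_map_subproof g x).

Definition is_fraisse_limit X : Prop :=
  (forall (A : structure L) (oA : obj F A),
     exists f : omega_lim X -> omega_lim (const_obj oA), is_omega_mor f) /\
  (forall (A B : structure L) (oA : obj F A) (oB : obj F B)
          (f : omega_lim X -> omega_lim (const_obj oA)) (g : B -> A),
     is_omega_mor f -> mor F g ->
     exists2 h : omega_lim X -> omega_lim (const_obj oB),
       is_omega_mor h & const_map oA g \o h = f).

Definition ledge_transitive X : Prop :=
  forall x y z : omega_lim X, ledge x y -> ledge y z -> ledge x z.

End OmegaCategory.

Arguments lproj {L F X} n x.

HB.mixin Record isTopologicalGroup G & Topological G & Group G := {
  mulg_continuous : continuous (fun xy : G * G => (xy.1 * xy.2)%g);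
  invg_continuous : continuous (fun x : G => (x^-1)%g) }.

#[short(type="topGroupType")]
HB.structure Definition TopGroup :=
  { G of Topological G & Group G & isTopologicalGroup G }.

(* Flows are nonempty: the empty flow would be vacuously minimal, and no
   minimal flow could then map onto all the others. *)
Record flow (G : topGroupType) := Flow {
  flow_space :> topologicalType;
  flow_hausdorff : hausdorff_space flow_space;
  flow_compact : compact [set: flow_space];
  flow_nonempty : [set: flow_space] !=set0;
  act : G -> flow_space -> flow_space;
  act1 : forall x, act 1%g x = x;
  actM : forall g h x, act (g * h)%g x = act g (act h x);
  act_continuous : continuous (fun gx : G * flow_space => act gx.1 gx.2) }.

Section Flows.
Context {G : topGroupType}.
Implicit Types M Y : flow G.

Definition minimal_flow M : Prop :=
  forall x : M, dense (range (fun g : G => act g x)).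

Definition universal_minimal_flow M : Prop :=
  minimal_flow M /\
  forall Y, minimal_flow Y -> exists phi : M -> Y,
    [/\ continuous phi,
        (forall (g : G) (x : M), phi (act g x) = act g (phi x))
      & (forall y : Y, exists x : M, phi x = y)].

End Flows.

Definition metrizable (R : realType) (T : topologicalType) : Prop :=
  exists (M : metricType R) (f : T -> M) (g : M -> T),
    [/\ continuous f, continuous g, cancel f g & cancel g f].

Record subgroup (G : groupType) := Subgroup {
  subgroup_set :> set G;
  subgroup1 : subgroup_set 1%g;
  subgroupM : forall x y, subgroup_set x -> subgroup_set y ->
    subgroup_set (x * y)%g;
  subgroupV : forall x, subgroup_set x -> subgroup_set (x^-1)%g }.

Section ClosedSubgroup.
Context {G : topGroupType} (S : subgroup G).

Lemma closure_subgroupM (x y : G) :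
  closure S x -> closure S y -> closure S (x * y)%g.
Proof.
move=> Sx Sy U /(@mulg_continuous G (x, y)) [[V W] /= [nV nW] VW].
have [a [Sa Va]] := Sx _ nV; have [b [Sb Wb]] := Sy _ nW.
by exists (a * b)%g; split; [exact: subgroupM | exact: (VW (a, b))].
Qed.

Lemma closure_subgroupV (x : G) : closure S x -> closure S (x^-1)%g.
Proof.
move=> Sx U /(@invg_continuous G x) nU; have [a [Sa Ua]] := Sx _ nU.
by exists (a^-1)%g; split => //; exact: subgroupV.
Qed.

Definition closed_subgroup : Type := set_type (closure S).

HB.instance Definition _ := Topological.on closed_subgroup.

Let csub (x : G) (Sx : closure S x) : closed_subgroup := SigSub (mem_set Sx).

Definition csub_one : closed_subgroup := csub (subset_closure (subgroup1 S)).
Definition csub_mul (x y : closed_subgroup) : closed_subgroup :=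
  csub (closure_subgroupM (set_valP x) (set_valP y)).
Definition csub_inv (x : closed_subgroup) : closed_subgroup :=
  csub (closure_subgroupV (set_valP x)).

Fact csub_mulA : associative csub_mul.
Proof. by move=> x y z; apply: val_inj => /=; exact: mulgA. Qed.
Fact csub_mul1 : left_id csub_one csub_mul.
Proof. by move=> x; apply: val_inj => /=; exact: mul1g. Qed.
Fact csub_mulr1 : right_id csub_one csub_mul.
Proof. by move=> x; apply: val_inj => /=; exact: mulg1. Qed.
Fact csub_mulV : left_inverse csub_one csub_inv csub_mul.
Proof. by move=> x; apply: val_inj => /=; exact: mulVg. Qed.
Fact csub_mulrV : right_inverse csub_one csub_inv csub_mul.
Proof. by move=> x; apply: val_inj => /=; exact: mulgV. Qed.

HB.instance Definition _ := isGroup.Build closed_subgroup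
  csub_mulA csub_mul1 csub_mulr1 csub_mulV csub_mulrV.

Let csub_continuous {T : topologicalType} (f : T -> closed_subgroup) :
  continuous (fun t => val (f t)) -> continuous f.
Proof.
move=> fc; apply/continuousP => _ [B oB <-].
by move/continuousP : fc; apply.
Qed.

Let val_continuous : continuous (val : closed_subgroup -> G).
Proof. exact: initial_continuous. Qed.

Fact csub_mul_continuous :
  continuous (fun xy : closed_subgroup * closed_subgroup => (xy.1 * xy.2)%g).
Proof.
apply: csub_continuous => -[x y] /=.
apply: (@continuous_comp _ _ _
  (fun xy : closed_subgroup * closed_subgroup => (val xy.1, val xy.2))
  (fun xy : G * G => (xy.1 * xy.2)%g)); last exact: mulg_continuous.
apply: cvg_pair => /=.
  by apply: (@cvg_comp _ _ _ fst val _ _ _ cvg_fst); exact: val_continuous.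
by apply: (@cvg_comp _ _ _ snd val _ _ _ cvg_snd); exact: val_continuous.
Qed.

Fact csub_inv_continuous : continuous (fun x : closed_subgroup => (x^-1)%g).
Proof.
apply: csub_continuous => x /=.
apply: (@continuous_comp _ _ _ (val : closed_subgroup -> G)
  (fun x : G => (x^-1)%g)); first exact: val_continuous.
exact: invg_continuous.
Qed.

HB.instance Definition _ := isTopologicalGroup.Build closed_subgroup
  csub_mul_continuous csub_inv_continuous.

End ClosedSubgroup.

Record homeo (X : topologicalType) := Homeo {
  homeo_fun :> X -> X;
  homeo_inv : X -> X;
  homeoK : cancel homeo_fun homeo_inv;
  homeoVK : cancel homeo_inv homeo_fun;
  homeo_continuous : continuous homeo_fun;
  homeo_inv_continuous : continuous homeo_inv }.

HB.instance Definition _ (X : topologicalType) := gen_eqMixin (homeo X).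
HB.instance Definition _ (X : topologicalType) := gen_choiceMixin (homeo X).

Section HomeoGroup.
Context {X : topologicalType}.
Implicit Types f g h : homeo X.

Lemma homeo_eq f g : f =1 g -> f = g.
Proof.
case: f g => [f f' fK fVK fc fc'] [g g' gK gVK gc gc'] /= /funext fg.
subst g; have f'g' : f' = g' by apply/funext => x; rewrite -{1}(gVK x) fK.
by subst g'; congr Homeo; exact: Prop_irrelevance.
Qed.

Definition homeo_one : homeo X :=
  @Homeo X id id (fun=> erefl) (fun=> erefl) (fun=> @cvg_id _ _) (fun=> @cvg_id _ _).

Definition homeo_mul f g : homeo X :=
  Homeo (can_comp (homeoK f) (homeoK g)) (can_comp (homeoVK g) (homeoVK f))
    (fun x => continuous_comp (@homeo_continuous _ g x)
                              (@homeo_continuous _ f (g x)))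
    (fun x => continuous_comp (@homeo_inv_continuous _ f x)
                              (@homeo_inv_continuous _ g (homeo_inv f x))).

Definition homeo_invg f : homeo X :=
  Homeo (homeoVK f) (homeoK f) (@homeo_inv_continuous _ f)
    (@homeo_continuous _ f).

Fact homeo_mulA : associative homeo_mul.
Proof. by move=> f g h; exact: homeo_eq. Qed.
Fact homeo_mul1 : left_id homeo_one homeo_mul.
Proof. by move=> f; exact: homeo_eq. Qed.
Fact homeo_mulr1 : right_id homeo_one homeo_mul.
Proof. by move=> f; exact: homeo_eq. Qed.
Fact homeo_mulV : left_inverse homeo_one homeo_invg homeo_mul.
Proof. by move=> f; apply: homeo_eq => x; exact: homeoK. Qed.
Fact homeo_mulrV : right_inverse homeo_one homeo_invg homeo_mul.
Proof. by move=> f; apply: homeo_eq => x; exact: homeoVK. Qed.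

HB.instance Definition _ := isGroup.Build (homeo X)
  homeo_mulA homeo_mul1 homeo_mulr1 homeo_mulV homeo_mulrV.

End HomeoGroup.

Lemma compact_unif_continuous (X Y : uniformType) (f : X -> Y) :
  compact [set: X] -> continuous f ->
  forall E : set (Y * Y), entourage E ->
  exists2 D : set (X * X), entourage D &
    forall a b, D (a, b) -> E (f a, f b).
Proof.
move=> /compact_near_coveringP cX fc E entE.
have [[x0 _]|nX] := pselect (exists x0 : X, True); last first.
  by exists setT => [|a]; [exact: filterT | case: nX; exists a].
have entX : ProperFilter (@entourage X).
  split; last exact: entourage_filter.
  by move=> /(@entourage_refl _ _ x0).
pose P (D : set (X * X)) (a : X) := forall b, D (a, b) -> E (f a, f b).
have Ploc : forall x, [set: X] x ->
    \forall x' \near x & D \near powerset_filter_from (@entourage X), P D x'.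
  move=> x _.
  have [D entD DE] : exists2 D : set (X * X), entourage D &
      forall y, D (x, y) -> split_ent E (f x, f y) /\ split_ent E (f y, f x).
    have : nbhs x [set y | split_ent E (f x, f y) /\ split_ent E (f y, f x)].
      apply: (fc x [set z | split_ent E (f x, z) /\ split_ent E (z, f x)]).
      rewrite -nbhs_entourageE.
      exists (split_ent E `&` (split_ent E)^-1%relation).
        by apply: filterI; [|apply: entourage_inv]; exact: entourage_split_ent.
      by move=> z /xsectionP [].
    rewrite -nbhs_entourageE => -[D entD DP]; exists D => // y Dxy.
    by apply: DP; apply/xsectionP.
  exists (xsection (split_ent D) x, [set B | entourage B /\ B `<=` split_ent D]).
    split; first by apply: nbhs_entourage; exact: entourage_split_ent.
    by apply: powerset_filter_fromP; exact: entourage_split_ent.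
  move=> [y B] [/= /xsectionP Dxy [entB BD]] b /BD Dyb.
  apply: (@entourage_split _ (f x)) => //.
    by apply: (DE y _).2; apply: split_ent_subset.
  by apply: (DE b _).1; apply: entourage_split Dxy Dyb.
have PF : Filter (powerset_filter_from (@entourage X)).
  exact: powerset_filter_from_filter.
have [Q [QE _ [D QD]] QP] := cX _ _ P PF Ploc.
exists D; first exact: QE.
by move=> a b; exact: (QP D QD a).
Qed.

Section HomeoUniform.
Context {X : uniformType} (cX : compact [set: X]).

(* The compactness hypothesis is what makes this a topological group. *)
Definition homeo_group : Type := let _ := cX in homeo X.

HB.instance Definition _ := Group.on homeo_group.
HB.instance Definition _ := Topological.copy homeo_group
  (initial_topology (fun h : homeo X => (h : {uniform X -> X}))).

Lemma homeo_nbhsP (f : homeo_group) (P : set homeo_group) :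
  nbhs f P <-> exists2 E : set (X * X), entourage E &
    forall g : homeo_group, (forall x, E (f x, g x)) -> P g.
Proof.
split=> [|[E entE EP]].
  rewrite nbhsE => -[_ [[B oB <-] Bf] BP].
  have /uniform_nbhs [E [entE EB]] : nbhs (homeo_fun f : {uniform X -> X}) B.
    by rewrite nbhsE; exists B.
  by exists E => // g Eg; apply: BP; apply: EB => /= x _; exact: Eg.
have nB : nbhs (homeo_fun f : {uniform X -> X})
    [set h : {uniform X -> X} | forall x, E (homeo_fun f x, h x)].
  by apply/uniform_nbhs; exists E; split=> // h hE x; exact: hE.
have fc : continuous (fun h : homeo_group => homeo_fun h : {uniform X -> X}).
  exact: initial_continuous.
have {}nB : nbhs f [set g : homeo_group | forall x, E (f x, g x)].
  exact: (fc f _ nB).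
by apply: filterS nB => g; exact: EP.
Qed.

Fact homeo_mul_continuous :
  continuous (fun fg : homeo_group * homeo_group => (fg.1 * fg.2)%g).
Proof.
move=> [f g] P /homeo_nbhsP [E entE EP].
have [D entD DE] := compact_unif_continuous cX (@homeo_continuous _ f)
  (entourage_split_ent entE).
exists ([set f' : homeo_group | forall x, split_ent E (f x, f' x)],
        [set g' : homeo_group | forall x, D (g x, g' x)]).
  split; apply/homeo_nbhsP; last by exists D.
  by exists (split_ent E) => //; exact: entourage_split_ent.
move=> [f' g'] [/= Ef Dg]; apply: EP => x.
by apply: (@entourage_split _ (f (g' x))) => //; exact: DE.
Qed.

Fact homeo_invg_continuous :
  continuous (fun f : homeo_group => (f^-1)%g).
Proof.
move=> f P /homeo_nbhsP [E entE EP].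
have [D entD DE] := compact_unif_continuous cX (@homeo_inv_continuous _ f) entE.
apply/homeo_nbhsP; exists D^-1%relation; first exact: entourage_inv.
move=> g Dg; apply: EP => x.
have := DE x (f (homeo_inv g x)); rewrite homeoK; apply.
by have := Dg (homeo_inv g x); rewrite /= homeoVK.
Qed.

HB.instance Definition _ := isTopologicalGroup.Build homeo_group
  homeo_mul_continuous homeo_invg_continuous.

End HomeoUniform.

Lemma compact_quotient (X : topologicalType) (e : equiv_rel X) :
  compact [set: X] -> compact [set: quotient_topology {eq_quot e}%qT].
Proof.
move=> cX; set Q := quotient_topology _.
have -> : [set: Q] = (\pi_Q : X -> Q)%qT @` [set: X].
  by apply/seteqP; split=> // q _; exists (repr q) => //; exact: reprK.
apply: continuous_compact cX; apply: continuous_subspaceT.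
exact: pi_continuous.
Qed.

Lemma hausdorff_quotient (R : realType) (X : topologicalType) (e : equiv_rel X) :
  compact [set: X] -> hausdorff_space X ->
  (forall x y, ~~ e x y -> \forall x' \near x & y' \near y, ~~ e x' y') ->
  hausdorff_space (quotient_topology {eq_quot e}%qT).
Proof.
move=> cX hX eC; set Q := quotient_topology _.
pose p : X -> Q := (\pi_Q)%qT.
have pe x y : p x = p y <-> e x y by split=> [/eqmodP|/eqmodP].
have psurj q : exists x, p x = q by exists (repr q); exact: reprK.
have satC (C : set X) : closed C -> open [set x | ~ exists2 c, C c & e c x].
  move=> cC; rewrite openE => x /= nx.
  have /compact_near_coveringP/near_covering_withinP cCx :=
    subclosed_compact cC cX (@subsetT _ C).
  have : \forall x' \near x, C `<=` [set c | ~~ e c x'].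
    apply: (cCx _ _ (fun x' c => ~~ e c x')) => c Cc.
    have := eC c x; case.
      by apply/negP => ecx; apply: nx; exists c.
    move=> [U V] [nU nV] UV; exists (U, V) => // -[a b] [/= Ua Vb] _.
    exact: (UV (a, b)).
  by apply: filterS => x' Cx' [c /Cx' /negP].
have clp x : closed (p @^-1` [set p x]).
  rewrite -openC (_ : ~` _ = [set y | ~ exists2 c, [set x] c & e c y]).
    by apply: satC; apply: accessible_closed_set1; exact: hausdorff_accessible.
  apply/seteqP; split=> y /=.
    by move=> + [_ -> /pe/esym].
  by move=> nxy pxy; apply: nxy; exists x => //; apply/pe.
rewrite open_hausdorff => q r; have [x <-] := psurj q; have [y <-] := psurj r.
move=> /eqP pxy.
have pI : (p @^-1` [set p x]) `&` (p @^-1` [set p y]) = set0.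
  by rewrite -subset0 => z [/= -> /pxy].
have /(@normal_openP R) nX := compact_normal hX cX.
have [U [V [oU oV xU yV UV0]]] := nX _ _ (clp x) (clp y) pI.
pose sh (W : set X) : set Q := [set a | p @^-1` [set a] `<=` W].
have osh W : open W -> open (sh W).
  move=> oW; have := satC _ (open_closedC oW); rewrite /open /= /quotient_open.
  congr open; apply/seteqP; split=> z /= h.
    by move=> w /= /pe ewz; apply: contrapT => nWw; apply: h; exists w.
  by move=> [c nWc /pe pcz]; apply/nWc/h.
exists (sh U, sh V); first by rewrite /= !inE.
split; [exact: osh | exact: osh | apply/eqP; rewrite -subset0 => a [/= aU aV]].
have [z za] := psurj a.
have : (U `&` V) z by split; [exact: aU | exact: aV].
by rewrite UV0.
Qed.

Section LimitSpace.
Context {L : language} {F : proj_fraisse L}.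
Implicit Types X Y : omega_obj F.

Lemma lproj_continuous X n :
  continuous (lproj n : omega_lim X -> discrete_topology (level X n)).
Proof.
move=> x; apply: (@continuous_comp _ (prod_topology (fun n => discrete_topology (level X n))) _ set_val (@^~ n)).
  exact: initial_continuous.
exact: proj_continuous.
Qed.

Lemma lproj_near X n (x : omega_lim X) :
  \forall y \near x, lproj n y = lproj n x.
Proof.
apply: (@lproj_continuous X n x [set lproj n x]); exact: discrete_set1.
Qed.

Lemma continuous_to_lim (T : topologicalType) X (f : T -> omega_lim X) :
  (forall n, continuous (fun t => lproj n (f t) : discrete_topology (level X n))) ->
  continuous f.
Proof.
move=> fc; apply/continuousP => _ [B oB <-].
suff /continuousP/(_ B oB) : continuous
  (fun t => set_val (f t) : prod_topology (fun n => discrete_topology (level X n))).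
  by [].
move=> t; apply/cvg_sup => n U [_ [[V oV <-] /= Vt] VU].
apply: filterS VU _; apply: (fc n t V).
exact: open_nbhs_nbhs.
Qed.

Lemma omega_mor_continuous X Y (h : omega_lim X -> omega_lim Y) :
  is_omega_mor h -> continuous h.
Proof.
move=> [i [phi [_ _ phiE]]]; apply: continuous_to_lim => n.
have -> : (fun t => lproj n (h t) : discrete_topology (level Y n)) =
          phi n \o lproj (i n) by rewrite -phiE.
have pc : continuous (phi n : discrete_topology (level X (i n)) ->
                              discrete_topology (level Y n)).
  by apply/continuousP => A _; exact: discrete_open.
move=> x; apply: (@continuous_comp _ (discrete_topology (level X (i n)))
  (discrete_topology (level Y n))); first exact: lproj_continuous.
exact: pc.
Qed.

Lemma omega_lim_compact X : compact [set: omega_lim X].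
Proof.
pose T := prod_topology (fun n => discrete_topology (level X n)).
have cP : compact [set: T].
  rewrite (_ : [set: T] =
      [set x : T | forall n, [set: discrete_topology (level X n)] (x n)]); last first.
    by apply/seteqP; split.
  apply: (@tychonoff nat (fun n => discrete_topology (level X n)) (fun=> setT)) => n.
  apply: finite_compact.
  by have [] := pf_finite_graph (level_obj X n).
have pnear (x : T) n : \forall y \near x, y n = x n.
  by apply: (@proj_continuous _ (fun n => discrete_topology (level X n)) n x [set x n]);
    exact: discrete_set1.
have cT : compact (@threads _ _ X).
  apply: subclosed_compact cP _ => //.
  rewrite -openC openE => x /= /existsNP [n xn].
  near=> y; apply/existsNP; exists n.
  by rewrite (near (pnear x n) y) // (near (pnear x n.+1) y).
move=> G PG _.
have [] := cT (set_val @ G) _.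
  by apply: (@filterS _ G _ setT) => [x _|]; [exact: set_valP | exact: filterT].
move=> p [Tp cp]; exists (SigSub (mem_set Tp)); split=> // A B GA.
rewrite nbhsE => -[_ [[V oV <-] /= Vp] VB].
have [_ [[a Aa <-] Va]] : (set_val @` A) `&` V !=set0.
  apply: cp.
    by apply: (@filterS _ G); [|exact: GA]; move=> a Aa; exists a.
  by rewrite nbhsE; exists V.
by exists a; split=> //; exact: VB.
Unshelve. all: by end_near.
Qed.

Lemma omega_lim_hausdorff X : hausdorff_space (omega_lim X).
Proof.
move=> x y xy; apply: lproj_inj => n.
by have [z [<- <-]] := xy _ _ (lproj_near n x) (lproj_near n y).
Qed.

Lemma ledge_refl X (x : omega_lim X) : ledge x x.
Proof.
by apply/ledgeE => n; have [_ + _] := pf_finite_graph (level_obj X n); apply.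
Qed.

Lemma ledge_sym X (x y : omega_lim X) : ledge x y -> ledge y x.
Proof.
move=> /ledgeE xy; apply/ledgeE => n.
by have [_ _] := pf_finite_graph (level_obj X n); apply.
Qed.

End LimitSpace.

Section LimitQuotient.
Context {L : language} {F : proj_fraisse L} {X : omega_obj F}.
Context (tr : ledge_transitive X).

Fact ledgeb_equiv : equiv_class_of (fun x y : omega_lim X => `[< ledge x y >]).
Proof.
split=> [x|x y|y x z]; first by apply/asboolP/ledge_refl.
  by apply/asboolP/asboolP; exact: ledge_sym.
by move=> /asboolP xy /asboolP yz; apply/asboolP/(tr xy).
Qed.

Definition ledge_equiv : equiv_rel (omega_lim X) := EquivRelPack ledgeb_equiv.

Definition lim_quotient : topologicalType :=
  quotient_topology {eq_quot ledge_equiv}%qT.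

Definition lim_pi : omega_lim X -> lim_quotient :=
  (\pi_(quotient_topology {eq_quot ledge_equiv}))%qT.

Lemma lim_piP (x y : omega_lim X) : lim_pi x = lim_pi y <-> ledge x y.
Proof.
split; first by move=> /eqmodP xy; apply/asboolP.
by move=> xy; apply/eqmodP/asboolP.
Qed.

Lemma lim_pi_surj (a : lim_quotient) : exists x, lim_pi x = a.
Proof. by exists (repr a); exact: reprK. Qed.

Lemma lim_quotient_compact : compact [set: lim_quotient].
Proof. exact/compact_quotient/omega_lim_compact. Qed.

Lemma lim_quotient_hausdorff (R : realType) : hausdorff_space lim_quotient.
Proof.
apply: (hausdorff_quotient R); first exact: omega_lim_compact.
  exact: omega_lim_hausdorff.
move=> x y /asboolP /ledgeE/existsNP [n nxy]; near=> x' y'.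
apply/asboolP => /ledgeE /(_ n).
by rewrite (near (lproj_near n x) x') // (near (lproj_near n y) y').
Unshelve. all: by end_near.
Qed.

Lemma lim_quotient_completely_regular (R : realType) :
  completely_regular_space lim_quotient.
Proof.
apply: (@normal_completely_regular R).
  by apply: compact_normal; [exact: (lim_quotient_hausdorff R) | exact: lim_quotient_compact].
exact/hausdorff_accessible/(lim_quotient_hausdorff R).
Qed.

(* A compact Hausdorff space has exactly one compatible uniformity, so the
   library's construction yields the usual uniform convergence topology,
   whatever compatible metric one would use to define it. *)
Definition lim_uniform (R : realType) : uniformType :=
  @completely_regular_uniformity.type R _ (lim_quotient_completely_regular R).

Lemma lim_uniform_compact (R : realType) : compact [set: lim_uniform R].
Proof. exact: lim_quotient_compact. Qed.

Definition HomeoF (R : realType) : topGroupType :=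
  homeo_group (lim_uniform_compact (R := R)).

End LimitQuotient.

Record omega_aut {L : language} {F : struct_category L} (X : omega_obj F) :=
  OmegaAut {
    aut_fun :> omega_lim X -> omega_lim X;
    aut_inv : omega_lim X -> omega_lim X;
    autK : cancel aut_fun aut_inv;
    autVK : cancel aut_inv aut_fun;
    aut_mor : is_omega_mor aut_fun;
    aut_inv_mor : is_omega_mor aut_inv }.

HB.instance Definition _ L F X := gen_eqMixin (@omega_aut L F X).
HB.instance Definition _ L F X := gen_choiceMixin (@omega_aut L F X).

Section AutGroup.
Context {L : language} {F : struct_category L} {X : omega_obj F}.
Implicit Types f g h : omega_aut X.

Lemma aut_eq f g : f =1 g -> f = g.
Proof.
case: f g => [f f' fK fVK fm fm'] [g g' gK gVK gm gm'] /= /funext fg.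
subst g; have f'g' : f' = g' by apply/funext => x; rewrite -{1}(gVK x) fK.
by subst g'; congr OmegaAut; exact: Prop_irrelevance.
Qed.

Definition aut_one : omega_aut X :=
  @OmegaAut L F X _ _ (fun=> erefl) (fun=> erefl) (omega_mor_id X)
    (omega_mor_id X).

Definition aut_mul f g : omega_aut X :=
  OmegaAut (can_comp (autK f) (autK g)) (can_comp (autVK g) (autVK f))
    (omega_mor_comp (aut_mor g) (aut_mor f))
    (omega_mor_comp (aut_inv_mor f) (aut_inv_mor g)).

Definition aut_invg f : omega_aut X :=
  OmegaAut (autVK f) (autK f) (aut_inv_mor f) (aut_mor f).

Fact aut_mulA : associative aut_mul.
Proof. by move=> f g h; exact: aut_eq. Qed.
Fact aut_mul1 : left_id aut_one aut_mul.
Proof. by move=> f; exact: aut_eq. Qed.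
Fact aut_mulr1 : right_id aut_one aut_mul.
Proof. by move=> f; exact: aut_eq. Qed.
Fact aut_mulV : left_inverse aut_one aut_invg aut_mul.
Proof. by move=> f; apply: aut_eq => x; exact: autK. Qed.
Fact aut_mulrV : right_inverse aut_one aut_invg aut_mul.
Proof. by move=> f; apply: aut_eq => x; exact: autVK. Qed.

HB.instance Definition _ := isGroup.Build (omega_aut X)
  aut_mulA aut_mul1 aut_mulr1 aut_mulV aut_mulrV.

End AutGroup.

Section Phi.
Context {L : language} {F : proj_fraisse L} {X : omega_obj F}.
Context (R : realType) (tr : ledge_transitive X).
Implicit Types f g : omega_aut X.

Let Q := lim_quotient tr.
Let q : omega_lim X -> Q := @lim_pi _ _ _ tr.

Definition quotient_lift (h : omega_lim X -> omega_lim X) (a : Q) : Q :=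
  q (h (repr a)).

Lemma quotient_liftE h x : is_omega_mor h -> quotient_lift h (q x) = q (h x).
Proof.
move=> hm; apply/lim_piP; apply: omega_mor_ledge => //.
by apply/(lim_piP tr); exact: (reprK (q x)).
Qed.

Lemma quotient_lift_continuous h : is_omega_mor h ->
  continuous (quotient_lift h : lim_uniform tr R -> lim_uniform tr R).
Proof.
move=> hm; suff : continuous (quotient_lift h : Q -> Q) by [].
apply/quotient_continuous; rewrite (_ : _ \o _ = q \o h); last first.
  by apply/funext => x; exact: quotient_liftE.
move=> x; apply: continuous_comp; first exact: omega_mor_continuous.
exact: pi_continuous.
Qed.

Lemma quotient_liftK h k : is_omega_mor h -> is_omega_mor k -> cancel h k ->
  cancel (quotient_lift h) (quotient_lift k).
Proof.
move=> hm km hk a; have [x <-] := lim_pi_surj a; rewrite -/(q x).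
by rewrite (quotient_liftE x hm) (quotient_liftE (h x) km) hk.
Qed.

Definition Phi f : HomeoF tr R := Homeo
   (quotient_liftK (aut_mor f) (aut_inv_mor f) (autK f))
   (quotient_liftK (aut_inv_mor f) (aut_mor f) (autVK f))
   (quotient_lift_continuous (aut_mor f))
   (quotient_lift_continuous (aut_inv_mor f)).

Lemma PhiE f (x : omega_lim X) : (Phi f : homeo _) (q x) = q (f x).
Proof. exact/quotient_liftE/aut_mor. Qed.

Lemma Phi1 : Phi 1%g = 1%g.
Proof.
apply: homeo_eq => a; have [x <-] := lim_pi_surj a.
exact: (quotient_liftE x (omega_mor_id X)).
Qed.

Lemma PhiM f g : Phi (f * g)%g = (Phi f * Phi g)%g.
Proof.
apply: homeo_eq => a; have [x <-] := lim_pi_surj a.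
rewrite [LHS]PhiE.
change (q (f (g x)) = (Phi f : homeo _) ((Phi g : homeo _) (q x))).
by rewrite !PhiE.
Qed.

Lemma PhiV f : Phi (f^-1)%g = ((Phi f)^-1)%g.
Proof. exact: homeo_eq. Qed.

Fact Phi_image1 : range Phi 1%g.
Proof. by exists 1%g => //; exact: Phi1. Qed.

Fact Phi_imageM x y : range Phi x -> range Phi y -> range Phi (x * y)%g.
Proof. by move=> [f _ <-] [g _ <-]; exists (f * g)%g => //; exact: PhiM. Qed.

Fact Phi_imageV x : range Phi x -> range Phi (x^-1)%g.
Proof. by move=> [f _ <-]; exists (f^-1)%g => //; exact: PhiV. Qed.

Definition Phi_image : subgroup (HomeoF tr R) := {|
  subgroup_set := range Phi;
  subgroup1 := Phi_image1;
  subgroupM := Phi_imageM;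
  subgroupV := Phi_imageV |}.

(* The closure is taken in [HomeoF tr R] and carries the subspace topology. *)
Definition closure_Phi_image : topGroupType := closed_subgroup Phi_image.

End Phi.

Section RamseyDegree.
Context (R : realType) {L : language} (F : struct_category L).
Implicit Types A B C : structure L.

Definition walk A (l : nat) (a b : A) : Prop :=
  exists p : nat -> A,
    [/\ p 0%N = a, p l = b & forall i, (i < l)%N -> edge (p i) (p i.+1)].

(* The infimum over the empty set of lengths is +oo. *)
Definition graph_dist A (a b : A) : \bar R :=
  ereal_inf [set (l%:R)%:E | l in [set l | walk l a b]].

Record Epi B A := MkEpi { epi_fun :> B -> A; epi_mor : mor F epi_fun }.

Definition epi_comp C B A (h : Epi B A) (f : Epi C B) : Epi C A :=
  MkEpi (mor_comp (epi_mor f) (epi_mor h)).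

(* For empty [B] this is -oo rather than 0; only comparisons with 1 matter. *)
Definition epi_dist B A (f g : Epi B A) : \bar R :=
  ereal_sup (range (fun b : B => graph_dist (f b) (g b))).

Definition epi_nbhd1 B A (X : set (Epi B A)) : set (Epi B A) :=
  [set g | exists2 f, X f & (epi_dist f g <= 1%:E)%E].

Definition approx_ramsey_degree_le A (k : nat) : Prop :=
  forall (B : structure L) (d : nat), obj F B ->
  exists2 C : structure L, obj F C &
  forall chi : Epi C A -> 'I_d,
  exists (f : Epi C B) (I : {set 'I_d}), (#|I| <= k)%N /\
    [set epi_comp h f | h in [set: Epi B A]] `<=`
      epi_nbhd1 (chi @^-1` [set i | i \in I]).

Definition approx_ramsey_degree A (k : nat) : Prop :=
  approx_ramsey_degree_le A k /\
  forall j : nat, approx_ramsey_degree_le A j -> (k <= j)%N.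

Definition finite_approx_ramsey_degree A : Prop :=
  exists k : nat, approx_ramsey_degree A k.

End RamseyDegree.

(* Main.v *)
From HB Require Import structures.
Require Import Defs.
From mathcomp Require Import all_boot all_order all_algebra.
From mathcomp Require Import all_classical all_reals all_analysis.

Set Implicit Arguments.
Unset Strict Implicit.
Unset Printing Implicit Defensive.

Import Order.TTheory GRing.Theory Num.Theory.
Import numFieldNormedType.Exports.
Local Open Scope classical_set_scope.
Local Open Scope ring_scope.

(** Let H be the automorphism group of the limit and G the closure of its image
    in the homeomorphism group of the quotient. Finiteness of all approximate
    Ramsey degrees and metrizability of the universal minimal flow of G are both
    equivalent to a third condition, built on [color_bound]: for each neighborhood
    U of 1 in G there is k such that, however G is colored with finitely many colors,
    every finite subset E of the image of H has a right translate E g that is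
    contained, up to left errors in U, in the union of k color classes.

    The link between [color_bound] and metrizability holds in every topological
    group with a countable base at 1 ([metrizable_umf_iff_color_bound]). The
    universal minimal flow is a minimal subflow M of the Samuel compactification
    S(G), the closure of G in the cube of all right uniformly continuous
    functions from G to [0, 1] ([universal_flow_of_subflow]). Suppose that k is a
    bound for U. If k + 1 points of a minimal flow had neighborhoods far from
    each other, color g by the neighborhood that contains g p, where p is a fixed
    point; a finite set E returning every point to every neighborhood would meet
    all these colors in each of its translates. So at every scale a minimal flow
    has a finite net ([color_bound_close]). The nets for a countable base of
    scales produce a countable base of entourages, and the flow is metrizable
    ([minimal_flow_metrizable]). Conversely, if the universal minimal flow is
    metrizable, then M is sequentially compact. But a convergent sequence of
    S(G) cannot consist of points that are pairwise apart at a fixed scale: a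
    right uniformly continuous function would separate the even terms of a
    subsequence from the odd ones ([apart_seq_not_convergent]). Hence M has a
    finite net at the scale U. Each point of the net is an accumulation point of
    one color class of G, and these classes suffice near every point of M, hence
    for a suitable translate of any finite set ([color_bound_of_metrizable]).

    The link between [color_bound] and Ramsey degrees comes from two properties
    of the limit. By a back-and-forth argument H acts transitively on the maps
    from the limit to a structure A that depend on finitely many levels
    ([limit_homogeneous]), so that colorings of the sets Epi(C, A) and colorings
    of G translate into each other. By compactness, and because R is an
    equivalence relation, the neighborhoods of 1 in G are described, on H, by the
    automorphisms that move points by at most one edge at a given level
    ([nbhs1_level], [cyl_nbhs1]), which matches the enlargement by 1 in the definition of
    the approximate Ramsey degree. One direction is then a translation
    ([ramsey_color_bound]). In the other one, colorings of the levels of the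
    limit which refute the Ramsey property converge along an ultrafilter to a
    coloring of G which refutes [color_bound] ([color_bound_ramsey]). *)

(** * Compact spaces and metrizability *)

Lemma near_seq (I : eqType) (T : Type) (F : set_system T) (s : seq I)
    (P : I -> T -> Prop) : Filter F ->
  (forall i, i \in s -> \forall t \near F, P i t) ->
  \forall t \near F, forall i, i \in s -> P i t.
Proof.
move=> FF; elim: s => [|i s IH] Ps; first by apply: nearW.
have /IH Ps' : forall j, j \in s -> \forall t \near F, P j t.
  by move=> j js; apply: Ps; rewrite inE js orbT.
apply: filterS2 (Ps i (mem_head _ _)) Ps' => t Pit Pst j.
by rewrite inE => /predU1P [->|/Pst].
Qed.

(** Points can be added greedily as long as no finite set is a net for N.
    Both finiteness arguments below refute the resulting infinite sequence. *)
Lemma infinite_apart (T : eqType) (N : T -> T -> Prop) :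
  (forall s : seq T, exists y, forall x, x \in s -> ~ N x y) ->
  exists y : nat -> T, forall m n, (m < n)%N -> ~ N (y m) (y n).
Proof.
move=> /choice [f fP]; pose s n := iter n (fun s => rcons s (f s)) [::].
exists (fun n => f (s n)) => m n mn; apply: fP.
elim: n mn => // n IH; rewrite ltnS leq_eqVlt /s iterS mem_rcons inE.
by move=> /predU1P [->|/IH ->]; rewrite ?eqxx ?orbT.
Qed.

Lemma continuous_pair (T U V : topologicalType) (f : T -> U) (g : T -> V) :
  continuous f -> continuous g -> continuous (fun t => (f t, g t)).
Proof. by move=> fc gc t; apply: cvg_pair; [exact: fc | exact: gc]. Qed.

Lemma hausdorff_pair (S T : topologicalType) :
  hausdorff_space S -> hausdorff_space T -> hausdorff_space (S * T)%type.
Proof.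
move=> hS hT [a b] [c d] ac; congr (_, _).
  apply: hS => U V nU nV.
  have [||[x y] [[/= Ux _] [/= Vx _]]] := ac (U `*` setT) (V `*` setT).
  - by exists (U, setT) => //; split=> //; exact: filterT.
  - by exists (V, setT) => //; split=> //; exact: filterT.
  by exists x.
apply: hT => U V nU nV.
have [||[x y] [[/= _ Uy] [/= _ Vy]]] := ac (setT `*` U) (setT `*` V).
- by exists (setT, U) => //; split=> //; exact: filterT.
- by exists (setT, V) => //; split=> //; exact: filterT.
by exists y.
Qed.

Lemma closed_preimage (T U : topologicalType) (f : T -> U) (C : set U) :
  continuous f -> closed C -> closed (f @^-1` C).
Proof. by move=> fc; apply: preimage_closed => t _; exact: fc. Qed.

Lemma compact_set_type (X : topologicalType) (A : set X) :
  compact A -> compact [set: set_type A].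
Proof.
move=> cA G PG _; have [] := cA (set_val @ G) _.
  by apply: (@filterS _ G _ setT) => [x _|]; [exact: set_valP | exact: filterT].
move=> p [Ap cp]; exists (SigSub (mem_set Ap)); split=> // B C GB.
rewrite nbhsE => -[_ [[V oV <-] /= Vp] VC].
have [_ [[a Ba <-] Va]] : (set_val @` B) `&` V !=set0.
  apply: cp; last by rewrite nbhsE; exists V.
  by apply: (@filterS _ G _ B) => // a Ba; exists a.
by exists a; split=> //; exact: VC.
Qed.

(** A compact space has only one compatible uniformity, so every neighborhood
    of the diagonal belongs to it. *)
Lemma compact_entourage (X : uniformType) (N : set (X * X)) :
  compact [set: X] -> (forall x, nbhs ((x, x) : X * X) N) -> entourage N.
Proof.
move=> /compact_near_coveringP cX diagN.
have [[x0 _]|nX] := pselect (exists x0 : X, True); last first.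
  by apply: filterS filterT => -[a]; case: nX; exists a.
have entX : ProperFilter (@entourage X).
  split; last exact: entourage_filter.
  by move=> /(@entourage_refl _ _ x0).
pose P (D : set (X * X)) (a : X) := forall b, D (a, b) -> N (a, b).
have Ploc x : [set: X] x ->
    \forall x' \near x & D \near powerset_filter_from (@entourage X), P D x'.
  move=> _; have [[U U'] /= [nU nU'] UN] := diagN x.
  have : nbhs x (U `&` U') by exact: filterI.
  rewrite -nbhs_entourageE => -[D entD DU].
  exists (xsection (split_ent D) x, [set B | entourage B /\ B `<=` split_ent D]).
    split; first by apply: nbhs_entourage; exact: entourage_split_ent.
    by apply: powerset_filter_fromP; exact: entourage_split_ent.
  move=> [y B] [/= /xsectionP Dxy [entB BD]] b /BD Dyb; apply: (UN (y, b)); split => /=.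
    by have [] := DU y; first by apply/xsectionP; exact: split_ent_subset.
  by have [] := DU b; first by apply/xsectionP; apply: entourage_split Dxy Dyb.
have PF : Filter (powerset_filter_from (@entourage X)).
  exact: powerset_filter_from_filter.
have [Q [QE _ [D QD]] QP] := cX _ _ P PF Ploc.
apply: filterS (QE _ QD) => -[a b]; exact: (QP D QD a).
Qed.

Lemma nbhs_diag_entourage (X : uniformType) (E : set (X * X)) (x : X) :
  entourage E -> nbhs ((x, x) : X * X) E.
Proof.
move=> entE; pose D := split_ent E `&` (split_ent E)^-1%relation.
have entD : entourage D.
  by apply: filterI; [|apply: entourage_inv]; exact: entourage_split_ent.
exists (xsection D x, xsection D x).
  by split; exact: nbhs_entourage.
move=> [y z] [/= /xsectionP [_ yx] /xsectionP [xz _]].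
exact: entourage_split yx xz.
Qed.

(** The compactness step behind both the metrizability criterion and the
    comparison of the levels of an inverse limit with its quotient. *)
Lemma compact_nested (X : topologicalType) (K : nat -> set X) (O : set X) :
  compact [set: X] -> (forall n, closed (K n)) ->
  (forall m n, (m <= n)%N -> K n `<=` K m) -> open O ->
  (forall x, (forall n, K n x) -> O x) -> exists n, K n `<=` O.
Proof.
move=> cX clK decK oO KO; apply: contrapT => /forallNP nKO.
have /choice [x xP] n : exists x, K n x /\ ~ O x.
  by have /existsNP [x /not_implyP] := nKO n; exists x.
have [p [_ xp]] := cX (x @ \oo) _ filterT.
have inK n : K n p.
  apply: clK => U nU; apply: xp nU; exists n => // m /= nm.
  by apply: decK nm _ _; have [] := xP m.
have [_ [[m _ <-] Oxm]] : (range x `&` O) !=set0.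
  apply: xp; first by exists 0%N => // n _; exists n.
  by apply: open_nbhs_nbhs; split=> //; exact: KO.
by case: (xP m).
Qed.

Section MetricOfPseudometric.
Context {R : realType} (T : pseudoMetricType R).
Hypothesis bounded2 : forall x y : T, ball x 2 y.
Hypothesis hT : hausdorff_space T.

Let dset (x y : T) : set R := [set e | 0 < e /\ ball x e y].
Let dist x y : R := inf (dset x y).

Let dset_has_inf x y : has_inf (dset x y).
Proof. by split; [exists 2; split|exists 0 => e [/ltW]]. Qed.

Let dist_le x y e : 0 < e -> ball x e y -> dist x y <= e.
Proof. by move=> e0 xy; apply: ge_inf => //; case: (dset_has_inf x y). Qed.

Let dist_lt x y e : dist x y < e -> ball x e y.
Proof.
move=> /(inf_lt (dset_has_inf x y).1) [d [d0 xdy] /ltW de].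
exact: le_ball de _ xdy.
Qed.

Let distxx x : dist x x = 0.
Proof.
apply/eqP; rewrite eq_le; apply/andP; split.
  apply/ler_addgt0Pl => e e0; rewrite addr0; apply: dist_le => //.
  exact: ballxx.
by apply: lb_le_inf => [|e [/ltW ? _]//]; case: (dset_has_inf x x).
Qed.

Let dist_eq0 x y : dist x y = 0 -> x = y.
Proof.
move=> xy0; apply: hT => U V /nbhs_ballP [e /= e0 eU] /nbhs_singleton Vy.
by exists y; split=> //; apply: eU; apply: dist_lt; rewrite xy0.
Qed.

Let dist_sym x y : dist x y = dist y x.
Proof. by congr inf; apply/seteqP; split=> e /= [e0 /ball_sym]. Qed.

Let dist_triangle y x z : dist x z <= dist x y + dist y z.
Proof.
apply/ler_addgt0Pr => e e0; have e2 : 0 < e / 2 by rewrite divr_gt0.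
have pos a b : 0 < dist a b + e / 2.
  apply: ltr_wpDl => //; apply: lb_le_inf => [|d [/ltW ? _]//].
  by case: (dset_has_inf a b).
rewrite [e]splitr addrACA; apply: dist_le; first by apply: addr_gt0; exact: pos.
by apply: (@ball_triangle _ _ y); apply: dist_lt; rewrite ltrDl.
Qed.

(** The balls of a pseudometric structure need not be the balls of a distance
    function; the infimum of the admissible radii is a distance function with
    the same entourages. The alias lets T keep its original structure. *)
Definition metric_copy : Type := let _ := bounded2 in let _ := hT in T.

HB.instance Definition _ := Choice.on metric_copy.
HB.instance Definition _ := @isMetric.Build R metric_copy dist
  distxx dist_eq0 dist_sym dist_triangle.

Lemma metrizable_metric_copy : metrizable R T.
Proof.
exists metric_copy, id, id; split=> // x U /nbhs_ballP [e /= e0 eU]; apply/nbhs_ballP.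
  exists (e / 2); first by rewrite /= divr_gt0.
  move=> y xy; apply: eU; rewrite ballEmdist /=.
  apply: (@le_lt_trans _ _ (e / 2)); first by apply: dist_le => //; rewrite divr_gt0.
  by rewrite ltr_pdivrMr // ltr_pMr // ltr1n.
exists e => // y; rewrite ballEmdist /= => xy; apply: eU.
exact: dist_lt.
Qed.

End MetricOfPseudometric.

Section CompactMetrizable.
Context {R : realType} (Y : topologicalType).
Hypotheses (cY : compact [set: Y]) (hY : hausdorff_space Y).

Lemma compact_hausdorff_completely_regular : completely_regular_space Y.
Proof.
apply: (@normal_completely_regular R); first exact: compact_normal.
exact: hausdorff_accessible.
Qed.

(** The sets W n witness that the diagonal is a G_delta set. By compactness
    their finite intersections form a base of entourages. *)
Lemma compact_metrizable (W : nat -> set (Y * Y)) :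
  (forall n, closed (W n)) -> (forall n x, nbhs ((x, x) : Y * Y) (W n)) ->
  (forall x y, (forall n, W n (x, y)) -> x = y) -> metrizable R Y.
Proof.
move=> clW nbW WI.
pose U : uniformType :=
  @completely_regular_uniformity.type R Y compact_hausdorff_completely_regular.
have cU : compact [set: U] by exact: cY.
have hU : hausdorff_space U by exact: hY.
pose K n : set (U * U) := \bigcap_(i in [set i | (i <= n)%N]) W i.
have nbK n x : nbhs ((x, x) : U * U) (K n).
  elim: n => [|n IH]; rewrite /K.
    rewrite (_ : [set i | (i <= 0)%N] = [set 0%N]) ?bigcap_set1; first exact: nbW.
    by apply/seteqP; split=> i /=; rewrite leqn0 => /eqP.
  rewrite (_ : [set i | (i <= n.+1)%N] = [set i | (i <= n)%N] `|` [set n.+1]).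
    by rewrite bigcap_setU bigcap_set1; apply: filterI => //; exact: nbW.
  apply/seteqP; split=> i /=.
    by rewrite leq_eqVlt ltnS => /predU1P [->|]; [right|left].
  by move=> [/leqW|->].
have cntU : countable_uniformity U.
  apply/countable_uniformityP; exists K; last first.
    by move=> n; apply: compact_entourage.
  move=> E entE.
  have [|||||n KE] := @compact_nested _ K E°.
  - by rewrite -setXTT; exact: compact_setX.
  - by move=> n; apply: closed_bigI => i _; exact: clW.
  - by move=> m n mn xy Kxy i /= im; apply: Kxy; exact: leq_trans im mn.
  - exact: open_interior.
  - move=> [x y] Kxy; rewrite (WI x y); first exact: nbhs_diag_entourage.
    by move=> n; apply: (Kxy n n) => /=.
  by exists n; apply: subset_trans KE _; exact: interior_subset.
pose P : pseudoMetricType R := countable_uniform cntU.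
exact: (@metrizable_metric_copy R P
  (countable_uniform.countable_uniform_bounded cntU) hY).
Qed.

End CompactMetrizable.

Lemma compact_urysohn (R : realType) (Y : topologicalType) (y : Y) (U : set Y) :
  compact [set: Y] -> hausdorff_space Y -> nbhs y U ->
  exists F : Y -> R, [/\ continuous F, (forall z, 0 <= F z <= 1), F y = 0 &
    forall z, F z < 1 -> U z].
Proof.
move=> cY hY nU.
have clU : closed (~` U°) by apply: open_closedC; exact: open_interior.
have nUy : ~ (~` U°) y by move=> h; apply: h.
have /(@uniform_separatorP _ R) [F [Fc F01 F0 F1]] :=
  compact_hausdorff_completely_regular (R := R) cY hY clU nUy.
exists F; split=> //.
- move=> z; have : range F (F z) by exists z.
  by move=> /F01; rewrite /= in_itv /=.
- by apply: F0; exists y.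
- move=> z Fz; apply: interior_subset; apply: contrapT => nz.
  by move: Fz; rewrite (F1 (F z)) ?ltxx //; exists z.
Qed.

Lemma metrizable_subsequence (R : realType) (X : topologicalType) (y : nat -> X) :
  compact [set: X] -> metrizable R X -> exists (z : X) (k : nat -> nat),
    {homo k : i j / (i < j)%N} /\
    forall U, nbhs z U -> exists N, forall n, (N <= n)%N -> U (y (k n)).
Proof.
move=> cX [M [f [g [fc gc fK gK]]]].
have [z [_ yz]] := cX (y @ \oo) _ filterT.
have /choice [b bP] (Nj : nat * nat) : exists n, (Nj.1 <= n)%N /\
    ball (f z) Nj.2.+1%:R^-1 (f (y n)).
  have nB : nbhs z (f @^-1` ball (f z) Nj.2.+1%:R^-1).
    by apply: fc; apply: nbhsx_ballx; rewrite invr_gt0 ltr0Sn.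
  have [_ [[n Nn <-] Bn]] : ([set y n | n in [set n | (Nj.1 <= n)%N]] `&`
      f @^-1` ball (f z) Nj.2.+1%:R^-1) !=set0.
    by apply: yz => //; exists Nj.1 => // n /= Nn; exists n.
  by exists n.
(* The j-th index is beyond the previous one, and its term is within
   1 / (j + 1) of the limit. *)
pose k := fix k j := if j is j'.+1 then b ((k j').+1, j) else b (0%N, 0%N).
have kB j : ball (f z) j.+1%:R^-1 (f (y (k j))).
  by case: j => [|j]; [exact: (bP (0, 0)%N).2|exact: (bP (_, j.+1)).2].
exists z, k; split.
  by apply: homo_ltn => [|j]; [exact: ltn_trans|exact: (bP ((k j).+1, j.+1)).1].
move=> U nU.
have : nbhs (f z) (g @^-1` U) by apply: gc; rewrite fK.
move=> /nbhs_ballP [e /= e0 eU].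
have [N Ne] : exists N : nat, N.+1%:R^-1 < e.
  exists (Num.truncn e^-1); rewrite invf_plt ?posrE //.
  exact: truncnS_gt.
exists N => n Nn; have := eU (f (y (k n))); rewrite /preimage /= fK; apply.
apply: le_ball (kB n); apply: le_trans (ltW Ne).
by rewrite lef_pV2 ?posrE // ler_nat ltnS.
Qed.

(** * Topological groups and their right uniformity *)

Section NearOne.
Context {G : topGroupType}.
Implicit Types (P : set G) (g u v : G).

Lemma continuous_mulg (T : topologicalType) (f h : T -> G) :
  continuous f -> continuous h -> continuous (fun t => (f t * h t)%g).
Proof.
move=> fc hc t; apply: (@continuous_comp _ _ _
  (fun t => (f t, h t)) (fun xy : G * G => (xy.1 * xy.2)%g)).
  exact: continuous_pair.
exact: mulg_continuous.
Qed.

Let cst_c (g : G) : continuous (fun _ : G => g).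
Proof. by move=> u; exact: cvg_cst. Qed.
Let id_c : continuous (fun g : G => g).
Proof. by move=> u; exact: cvg_id. Qed.

Lemma near_conjg P g : nbhs (1%g : G) P ->
  \forall u \near (1%g : G), P (g * u * g^-1)%g.
Proof.
move=> P1; have c : continuous (fun u : G => (g * u * g^-1)%g).
  by do 2![apply: continuous_mulg => //].
by apply: (c 1%g P); rewrite mulg1 mulgV.
Qed.

Lemma near_invg P : nbhs (1%g : G) P -> \forall u \near (1%g : G), P (u^-1)%g.
Proof. by move=> P1; apply: (@invg_continuous G 1%g P); rewrite invg1. Qed.

Lemma near_mulg P : nbhs (1%g : G) P ->
  exists2 V, nbhs (1%g : G) V & forall u v, V u -> V v -> P (u * v)%g.
Proof.
move=> P1.
have : nbhs (1%g : G, 1%g : G) [set xy : G * G | P (xy.1 * xy.2)%g].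
  by apply: (@mulg_continuous G (1%g, 1%g) P); rewrite /= mulg1.
move=> [[V W] /= [nV nW] VW]; exists (V `&` W); first exact: filterI.
by move=> u v [Vu _] [_ Wv]; exact: (VW (u, v)).
Qed.

(** Products of four factors cover all the estimates below. *)
Lemma symmetric_nbhs1 P : nbhs (1%g : G) P -> exists V,
  [/\ nbhs (1%g : G) V, (forall u, V u -> V (u^-1)%g) &
      forall a b c d, V a -> V b -> V c -> V d -> P (a * b * c * d)%g].
Proof.
move=> /near_mulg [V1 /near_mulg [V2 nV2 V21] V1P].
exists (V2 `&` [set u | V2 (u^-1)%g]); split.
- by apply: filterI => //; exact: near_invg.
- by move=> u [Vu Vu']; split=> //=; rewrite invgK.
- move=> a b c d [Va _] [Vb _] [Vc _] [Vd _].
  by rewrite -mulgA; apply: V1P; exact: V21.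
Qed.

Lemma nbhs_mulgVr P g : nbhs (1%g : G) P -> \forall h \near g, P (h * g^-1)%g.
Proof.
move=> P1; have c : continuous (fun u : G => (u * g^-1)%g) by exact: continuous_mulg.
by apply: (c g P); rewrite mulgV.
Qed.

End NearOne.

Section RightUniformity.
Context {G : topGroupType}.

(** An alias of G for the uniformity in which g and h are close when h = u g
    with u close to 1. *)
Definition right_uniform : Type := G.

Definition right_ent : set_system (right_uniform * right_uniform) :=
  [set E | \forall u \near (1%g : G), forall g : G, E (g, (u * g)%g)].

Let ent_filter : Filter right_ent.
Proof.
split; first exact: (@nearW _ (nbhs (1%g : G))).
- rewrite /right_ent /= => A B; apply: (@filterS2 _ (nbhs (1%g : G)))
    => u Au Bu g.
  by split; [exact: Au|exact: Bu].
- move=> A B AB; apply: (@filterS _ (nbhs (1%g : G))) => u Au g; exact: AB.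
Qed.

Let ent_refl E : right_ent E -> diagonal `<=` E.
Proof. by move=> /nbhs_singleton E1 [g h] /diagonalP <-; rewrite -{2}[g]mul1g. Qed.

Let ent_inv E : right_ent E -> right_ent E^-1%relation.
Proof.
move=> /near_invg; apply: filterS => u Eu g.
by have := Eu (u * g)%g; rewrite mulgA mulVg mul1g.
Qed.

Let ent_split E : right_ent E -> exists2 B, right_ent B & (B \; B `<=` E)%relation.
Proof.
move=> /near_mulg [V nV VE].
exists [set gh | exists2 u : G, V u & gh.2 = (u * gh.1)%g].
  by apply: filterS nV => u Vu g; exists u.
by move=> [g h] [k [/= u Vu ->] [/= v Vv ->]]; rewrite mulgA; exact: VE.
Qed.

HB.instance Definition _ := Choice.on right_uniform.
HB.instance Definition _ := @isUniform.Build right_uniform right_ent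
  ent_filter ent_refl ent_inv ent_split.

End RightUniformity.

Section Ruc.
Context {R : realType} {G : topGroupType}.

(** Right uniform continuity, normalized to values in [0, 1]. Such functions
    arise from orbits in compact flows ([orbit_ruc]), which is why they suffice
    to build the universal minimal flow. *)
Definition ruc (f : G -> R) : Prop :=
  (forall g, 0 <= f g <= 1) /\
  forall e : R, 0 < e -> \forall u \near (1%g : G), forall g, `|f (u * g)%g - f g| <= e.

Section Urysohn.
Variables (V T : set G).
Hypothesis V1 : nbhs (1%g : G) V.

Let E : set (right_uniform * right_uniform) :=
  [set gh : G * G | V (gh.2 * gh.1^-1)%g].

Let entE : @entourage (@right_uniform G) E.
Proof. by apply: filterS V1 => u Vu g; rewrite /E /= -mulgA mulgV mulg1. Qed.

Let X : pseudoMetricType R := gauge.type entE.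

(** The pseudometric that metrizes a single entourage of the right uniformity
    is itself right uniformly continuous, hence so is the truncated distance to T. *)
Lemma ruc_urysohn : exists f : G -> R, [/\ ruc f, (forall g, T g -> f g = 1) &
  forall g, f g != 0 -> exists v t, [/\ V v, T t & g = (v * t)%g]].
Proof.
have : @entourage X E by exists 0%N => // ? [].
rewrite -entourage_ballE => -[d /= d0 dE].
(* Since d belongs to S z, the infimum D z is the distance to T truncated at
   d, also when T is empty. *)
pose S (z : X) : set R :=
  [set e | e = d \/ 0 < e /\ exists2 t, T t & ball (t : X) e z].
have S0 z : S z !=set0 by exists d; left.
have Slb z : lbound (S z) 0 by move=> e [->|[/ltW]] //; exact: ltW.
have Sinf z : has_lbound (S z) by exists 0.
pose D z := inf (S z).
have D_ge0 z : 0 <= D z by exact: lb_le_inf.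
have D_le z : D z <= d by apply: ge_inf => //; left.
have D_lip z z' e : 0 < e -> ball z e z' -> D z' <= D z + e.
  move=> e0 zz'; rewrite -lerBlDr; apply: lb_le_inf => // a Sa; rewrite lerBlDr.
  case: Sa => [->|[a0 [t Tt ta]]].
    by apply: (le_trans (D_le _)); rewrite lerDl ltW.
  apply: ge_inf => //; right; split; first exact: addr_gt0.
  by exists t => //; exact: ball_triangle ta zz'.
exists (fun g => 1 - D g / d); split.
- split=> [g|e e0].
    by rewrite subr_ge0 lerBlDr lerDl ler_pdivrMr // mul1r D_le divr_ge0 // ltW.
  have : @entourage X [set xy | ball xy.1 (e * d) xy.2].
    by rewrite -entourage_ballE; exists (e * d) => //=; exact: mulr_gt0.
  move=> /(@gauge.gauge_ent (@right_uniform G) E entE).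
  apply: (@filterS _ (nbhs (1%g : G))) => u uB g.
  have guB : ball (g : X) (e * d) (u * g)%g by exact: uB.
  have ed0 : 0 < e * d by exact: mulr_gt0.
  rewrite opprB addrC addrA subrK -mulrBl normrM normfV (gtr0_norm d0).
  rewrite ler_pdivrMr // ler_norml lerBlDl lerBrDl lerBlDr.
  by apply/andP; split; apply: D_lip => //; exact: ball_sym.
- move=> g Tg; have -> : D g = 0; last by rewrite mul0r subr0.
  apply/eqP; rewrite eq_le D_ge0 andbT; apply/ler_addgt0Pr => e e0; rewrite add0r.
  by apply: ge_inf => //; right; split=> //; exists g => //; exact: ballxx.
- move=> g; apply: contraNP => nVT; rewrite subr_eq0 eq_sym.
  have -> : D g = d; last by rewrite divff // gt_eqF.
  apply/eqP; rewrite eq_le D_le; apply: lb_le_inf => // e [->//|[e0 [t Tt tg]]].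
  rewrite leNgt; apply/negP => ed; apply: nVT; exists (g * t^-1)%g, t.
  split=> //; last by rewrite -mulgA mulVg mulg1.
  by apply: (dE (t, g)); apply: le_ball tg; exact: ltW.
Qed.

End Urysohn.

(** Left translations preserve right uniform continuity because
    g u = (g u g^-1) g. *)
Lemma ruc_shift (f : G -> R) (g : G) : ruc f -> ruc (fun h => f (g * h)%g).
Proof.
move=> [f01 fu]; split=> // e e0; apply: filterS (near_conjg g (fu e e0)) => u fgu h.
by have := fgu (g * h)%g; rewrite !mulgA mulgVK.
Qed.

End Ruc.

(** * The Samuel compactification *)

Section Samuel.
Context {R : realType} {G : topGroupType}.

Record ruc_fun := RucFun { ruc_val :> G -> R; ruc_valP : ruc ruc_val }.

HB.instance Definition _ := gen_eqMixin ruc_fun.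
HB.instance Definition _ := gen_choiceMixin ruc_fun.

Lemma ruc_fun_eq (f f' : ruc_fun) : f =1 f' -> f = f'.
Proof.
case: f f' => [f fr] [f' fr'] /= /funext ff'; subst f'.
by congr RucFun; exact: Prop_irrelevance.
Qed.

Definition ruc_shift_fun (g : G) (f : ruc_fun) : ruc_fun :=
  RucFun (ruc_shift g (ruc_valP f)).

Definition samuel_ambient : topologicalType :=
  prod_topology (fun _ : ruc_fun => (R : topologicalType)).

Implicit Types (f : ruc_fun) (xi : samuel_ambient) (g h : G).

Lemma ambient_ev_continuous f : continuous (fun xi => xi f : R).
Proof. exact: (@proj_continuous _ (fun _ : ruc_fun => (R : topologicalType)) f). Qed.

Lemma continuous_to_ambient (T : topologicalType) (k : T -> samuel_ambient) :
  (forall f, continuous (fun t => k t f : R)) -> continuous k.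
Proof.
move=> kc t; apply/cvg_sup => f U [_ [[V oV <-] /= Vt] VU].
by apply: filterS VU _; apply: (kc f t V); exact: open_nbhs_nbhs.
Qed.

Definition samuel_of (g : G) : samuel_ambient := fun f => f g.

(** The greatest ambit of G. It is cut out of a product of lines, in which
    evaluation at a function is a projection and hence continuous. *)
Definition samuel : set samuel_ambient := closure (range samuel_of).

Definition samuel_act (g : G) (xi : samuel_ambient) : samuel_ambient :=
  fun f => xi (ruc_shift_fun g f).

Lemma ruc_continuous f : continuous f.
Proof.
case: f => f [f01 fu] /= g; apply/cvgrPdist_le => e e0.
apply: filterS (nbhs_mulgVr g (fu e e0)) => h /(_ g).
by rewrite -mulgA mulVg mulg1 distrC.
Qed.

Lemma samuel_of_continuous : continuous samuel_of.
Proof. by apply: continuous_to_ambient => f; exact: ruc_continuous. Qed.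

Lemma samuel_in g : samuel (samuel_of g).
Proof. by apply: subset_closure; exists g. Qed.

Lemma samuel_approx (D : set G) xi (U : set samuel_ambient) :
  dense D -> samuel xi -> nbhs xi U -> exists2 g, D g & U (samuel_of g).
Proof.
move=> dD Sxi; rewrite nbhsE => -[V [oV Vxi] VU].
have [_ [[g _ <-] Vg]] := Sxi V (open_nbhs_nbhs (conj oV Vxi)).
have [||h [Vh Dh]] := dD (samuel_of @^-1` V).
- by exists g.
- by apply: open_comp => // ? _; exact: samuel_of_continuous.
by exists h => //; exact: VU.
Qed.

Lemma samuel_closed_ind (C : set samuel_ambient) :
  closed C -> (forall g, C (samuel_of g)) -> samuel `<=` C.
Proof.
move=> clC CG; rewrite (closure_id C).1 //.
by apply: closureS => _ [g _ <-].
Qed.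

Lemma closed_samuel : closed samuel.
Proof. exact: closed_closure. Qed.

Lemma samuel_compact : compact samuel.
Proof.
apply: (@subclosed_compact _ _ [set xi : samuel_ambient | forall f, `[0, 1]%classic (xi f)]).
- exact: closed_samuel.
- apply: (@tychonoff ruc_fun (fun=> R : topologicalType) (fun=> `[0, 1]%classic)) => _.
  exact: segment_compact.
- apply: samuel_closed_ind; last first.
    by move=> g f /=; case: f => f [f01 _] /=; rewrite in_itv /=.
  rewrite (_ : [set _ | _] =
      \bigcap_f ((fun xi : samuel_ambient => xi f : R) @^-1` `[0, 1]%classic)).
    apply: closed_bigI => f _; apply: closed_preimage; first exact: ambient_ev_continuous.
    exact: (compact_closed (@Rhausdorff R) (@segment_compact R 0 1)).
  by apply/seteqP; split=> [xi xi01 f _|xi xi01 f]; [exact: xi01|exact: (xi01 f)].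
Qed.

Lemma ambient_hausdorff : hausdorff_space samuel_ambient.
Proof.
apply: (@hausdorff_product _ (fun _ : ruc_fun => (R : topologicalType))) => _.
exact: Rhausdorff.
Qed.

Lemma samuel_act_continuous g : continuous (samuel_act g).
Proof. by apply: continuous_to_ambient => f; exact: ambient_ev_continuous. Qed.

Lemma samuel_act_of g h : samuel_act g (samuel_of h) = samuel_of (g * h)%g.
Proof. by []. Qed.

Lemma samuel_act1 xi : samuel_act 1%g xi = xi.
Proof.
apply: functional_extensionality_dep => f; congr xi.
by apply: ruc_fun_eq => h /=; rewrite mul1g.
Qed.

Lemma samuel_actM g h xi : samuel_act (g * h)%g xi = samuel_act g (samuel_act h xi).
Proof.
apply: functional_extensionality_dep => f; congr xi.
by apply: ruc_fun_eq => k /=; rewrite mulgA.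
Qed.

Lemma samuel_act_samuel g xi : samuel xi -> samuel (samuel_act g xi).
Proof.
move: xi; apply: (@samuel_closed_ind (samuel_act g @^-1` samuel)).
  by apply: closed_preimage; [exact: samuel_act_continuous | exact: closed_samuel].
by move=> h; rewrite /= samuel_act_of; exact: samuel_in.
Qed.

(** Estimates that are uniform on G persist on its closure. *)
Lemma samuel_lip xi f f' (e : R) : samuel xi ->
  (forall g, `|f g - f' g| <= e) -> `|xi f - xi f'| <= e.
Proof.
move=> + ff'; move: xi.
apply: (@samuel_closed_ind [set xi | `|xi f - xi f'| <= e]); last exact: ff'.
apply: (@closed_preimage _ _ (fun xi : samuel_ambient => `|xi f - xi f'|) [set x : R | x <= e]);
  last exact: closed_le.
move=> xi; apply: (@continuous_comp _ _ _
  (fun xi : samuel_ambient => xi f - xi f' : R) (fun x : R => `|x|)).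
  apply: (@continuousB _ _ _ (fun xi : samuel_ambient => xi f : R)
    (fun xi : samuel_ambient => xi f' : R)); exact: ambient_ev_continuous.
exact: norm_continuous.
Qed.

End Samuel.

Section Subflows.
Context {R : realType} {G : topGroupType}.
Local Notation ambient := (@samuel_ambient R G).
Local Notation samuel := (@samuel R G).
Implicit Types (f : @ruc_fun R G) (xi : ambient) (g h : G) (M N : set ambient).

Definition subflow M : Prop := [/\ closed M, M !=set0, M `<=` samuel &
  forall g xi, M xi -> M (samuel_act g xi)].

Lemma subflow_samuel : subflow samuel.
Proof.
split=> //; first exact: closed_samuel.
- by exists (samuel_of 1%g); exact: samuel_in.
- exact: samuel_act_samuel.
Qed.

Definition minimal_subflow M : Prop :=
  subflow M /\ forall N, subflow N -> N `<=` M -> M `<=` N.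

(** Zorn's lemma is applied to the complements in S(G), so that unions of
    chains become intersections of subflows, which are nonempty by compactness. *)
Lemma minimal_subflow_exists : exists M, minimal_subflow M.
Proof.
have [|A [[AS sA] maxA]] :=
    @Zorn_bigcup _ [set A | A `<=` samuel /\ subflow (samuel `\` A)].
  move=> F FP totF; set A := \bigcup_(X in F) X.
  split; first by move=> xi [X /FP [XS _]] /XS.
  have [F0|/set0P [X0 FX0]] := eqVneq F set0.
    by rewrite /A F0 bigcup_set0 setD0; exact: subflow_samuel.
  have AE : samuel `\` A = \bigcap_(X in F) (samuel `\` X).
    apply/seteqP; split=> [xi [Sxi nA] X FX|xi Axi].
      by split=> // Xxi; apply: nA; exists X.
    have [Sxi _] := Axi _ FX0; split=> // -[X FX Xxi].
    by have [_] := Axi _ FX.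
  have FF : Filter (filter_from F (fun X => samuel `\` X)).
    apply: filter_from_filter; first by exists X0.
    move=> X Y FX FY; have [XY|YX] := totF _ _ FX FY.
      by exists Y => // xi [Sxi nY]; do !split=> //; move=> /XY.
    by exists X => // xi [Sxi nX]; do !split=> //; move=> /YX.
  have PF : ProperFilter (filter_from F (fun X => samuel `\` X)).
    by apply: filter_from_proper => X /FP [_ []].
  have [|p [Sp cp]] := @samuel_compact R G _ PF.
    by exists X0 => // xi [].
  rewrite AE; split.
  - by apply: closed_bigI => X /FP [_ []].
  - exists p => X FX; have [_ [clX _ _ _]] := FP _ FX.
    by apply: clX => U; apply: cp; exists X.
  - by move=> xi /(_ _ FX0) [].
  - move=> g xi Axi X FX; have [_ [_ _ _ +]] := FP _ FX; apply.
    exact: Axi.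
exists (samuel `\` A); split=> // N sN NA; have [_ _ NS _] := sN.
apply: contrapT => nAN; apply: (maxA (samuel `\` N)); last first.
  split; first by move=> xi [].
  by rewrite setDD (setIidr NS).
split.
  by move=> xi Axi; split; [exact: AS|move=> /NA [_]; apply].
move=> NAA; apply: nAN => xi [Sxi nAxi]; apply: contrapT => nN.
by apply: nAxi; apply: NAA.
Qed.

Section FlowOfSubflow.
Context M (sM : subflow M).

Definition subflow_point xi (Mxi : M xi) : set_type M := SigSub (mem_set Mxi).

Definition subflow_act (g : G) (x : set_type M) : set_type M :=
  subflow_point (let: And4 _ _ _ MG := sM in MG g (set_val x) (set_valP x)).

Lemma continuous_to_subflow (T : topologicalType) (k : T -> set_type M) :
  continuous (set_val \o k : T -> ambient) -> continuous k.
Proof.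
move=> kc; apply/continuousP => _ [B oB <-].
by move/continuousP : kc; apply.
Qed.

Let val_continuous : continuous (set_val : set_type M -> ambient).
Proof. exact: initial_continuous. Qed.

Let val_samuel (x : set_type M) : samuel (set_val x).
Proof. by have [_ _ + _] := sM; apply; exact: set_valP. Qed.

Let sf_hausdorff : hausdorff_space (set_type M).
Proof.
move=> x y xy; apply: val_inj; apply: ambient_hausdorff => A B nA nB.
have [z [Az Bz]] := xy _ _ (val_continuous nA) (val_continuous nB).
by exists (set_val z).
Qed.

Let sf_compact : compact [set: set_type M].
Proof.
have [clM _ MS _] := sM; apply: compact_set_type.
exact: subclosed_compact clM samuel_compact MS.
Qed.

Let sf_nonempty : [set: set_type M] !=set0.
Proof. by have [_ [xi Mxi] _ _] := sM; exists (subflow_point Mxi). Qed.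

Let sf_act1 x : subflow_act 1%g x = x.
Proof. by apply: val_inj; exact: samuel_act1. Qed.

Let sf_actM g h x : subflow_act (g * h)%g x = subflow_act g (subflow_act h x).
Proof. by apply: val_inj; exact: samuel_actM. Qed.

Let sf_act_continuous :
  continuous (fun gx : G * set_type M => subflow_act gx.1 gx.2).
Proof.
apply: continuous_to_subflow; apply: continuous_to_ambient => f [g x] /=.
apply/cvgrPdist_le => e e0; have e2 : 0 < e / 2 by rewrite divr_gt0.
have nG : \forall g' \near g, forall h, `|f (g' * h)%g - f (g * h)%g| <= e / 2.
  apply: filterS (nbhs_mulgVr g ((ruc_valP f).2 _ e2)) => g' fg' h.
  by have := fg' (g * h)%g; rewrite mulgA mulgVK.
have nX : \forall x' \near x,
    `|set_val x (ruc_shift_fun g f) - set_val x' (ruc_shift_fun g f)| <= e / 2.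
  have c : continuous (fun x' : set_type M => set_val x' (ruc_shift_fun g f) : R).
    move=> y; apply: (@continuous_comp _ ambient _ set_val (fun xi => xi _)).
      exact: val_continuous.
    exact: ambient_ev_continuous.
  by have /cvgrPdist_le := c x; apply.
exists ([set g' | forall h, `|f (g' * h)%g - f (g * h)%g| <= e / 2],
  [set x' | `|set_val x (ruc_shift_fun g f) - set_val x' (ruc_shift_fun g f)| <= e / 2]) => //.
move=> [g' x'] [/= gg' xx']; rewrite /samuel_act [e]splitr.
apply: (le_trans (ler_distD (set_val x' (ruc_shift_fun g f)) _ _)).
apply: lerD => //; apply: samuel_lip => // h /=.
by rewrite distrC.
Qed.

Definition flow_of_subflow : flow G :=
  @Flow G (set_type M) sf_hausdorff sf_compact sf_nonempty subflow_act
    sf_act1 sf_actM sf_act_continuous.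

End FlowOfSubflow.

End Subflows.

(** * Universality of the minimal subflows *)

Section Action.
Context {G : topGroupType} (Y : flow G).

Lemma act_continuousl (y : Y) : continuous (fun g : G => act g y).
Proof.
move=> g; apply: (@continuous_comp _ _ _ (fun g : G => (g, y))
  (fun gy : G * Y => act gy.1 gy.2)); last exact: act_continuous.
by apply: continuous_pair => h; [exact: cvg_id | exact: cvg_cst].
Qed.

Lemma act_continuousr (g : G) : continuous (act g : Y -> Y).
Proof.
move=> y; apply: (@continuous_comp _ _ _ (fun y : Y => (g, y))
  (fun gy : G * Y => act gy.1 gy.2)); last exact: act_continuous.
by apply: continuous_pair => z; [exact: cvg_cst | exact: cvg_id].
Qed.

End Action.

Section Universality.
Context {R : realType} {G : topGroupType}.
Local Notation ambient := (@samuel_ambient R G).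
Local Notation samuel := (@samuel R G).
Implicit Types (f : @ruc_fun R G) (xi : ambient) (g h : G) (M N : set ambient).

Lemma minimal_flow_of_subflow M (mM : minimal_subflow M) :
  minimal_flow (flow_of_subflow mM.1).
Proof.
move=> x; set xi := set_val x.
have Mxi : M xi by exact: set_valP.
have [[clM M0 MS MG] minM] := mM.
pose N := closure (range (fun g : G => samuel_act g xi)).
have NM : N `<=` M.
  by rewrite (closure_id M).1 //; apply: closureS => _ [g _ <-]; exact: MG.
have sN : subflow N.
  split; first exact: closed_closure.
  - by exists (samuel_act 1%g xi); apply: subset_closure; exists 1%g.
  - exact: subset_trans NM MS.
  - move=> g eta Neta U /(@samuel_act_continuous R G g) /Neta [_ [[h _ <-] Uh]].
    by exists (samuel_act (g * h)%g xi); split; [exists (g * h)%g|rewrite samuel_actM].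
move=> O [y Oy] [V oV VO]; rewrite -{O}VO in Oy *; have Vy : V (set_val y) := Oy.
have [_ [[g _ <-] Vg]] := minM _ sN NM _ (set_valP y) V (open_nbhs_nbhs (conj oV Vy)).
by exists (subflow_act mM.1 g x); split; last by exists g.
Qed.

(** By compactness of Y, F (u y) tends to F y uniformly in y as u tends to 1. *)
Lemma orbit_ruc (Y : flow G) (y0 : Y) (F : Y -> R) :
  continuous F -> (forall y, 0 <= F y <= 1) ->
  exists f, forall g, f g = F (act g y0).
Proof.
move=> Fc F01; suff Fr : ruc (fun g : G => F (act g y0)).
  by exists (RucFun Fr).
split=> // e e0.
pose P (u : G) (y : Y) := `|F (act u y) - F y| <= e.
have : \forall u \near (1%g : G), [set: Y] `<=` P u.
  have /compact_near_coveringP cY := @flow_compact G Y.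
  apply: cY => y _; have e2 : 0 < e / 2 by rewrite divr_gt0.
  have c : continuous (fun uy : G * Y => F (act uy.1 uy.2)).
    move=> uy; apply: (@continuous_comp _ _ _ (fun uy : G * Y => act uy.1 uy.2) F).
      exact: act_continuous.
    exact: Fc.
  have /cvgrPdist_le /(_ _ e2) [[A B] /= [nA nB] AB] := c (1%g, y).
  have /cvgrPdist_le /(_ _ e2) nC := Fc y.
  exists (B `&` [set z | `|F y - F z| <= e / 2], A); first by split=> //; apply: filterI.
  move=> [z u] [/= [Bz yz] Au]; rewrite /P [e]splitr.
  apply: (le_trans (ler_distD (F y) _ _)); apply: lerD => //.
  by have := AB (u, z) (conj Au Bz); rewrite /= act1 distrC.
by apply: filterS => u uP g; have := uP (act g y0) I; rewrite /P actM.
Qed.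

(** The orbit map of y0 extends to S(G): the coordinates of xi prescribe the
    value at phi xi of each continuous function on Y, and by compactness some
    point of Y has all the prescribed values. *)
Lemma samuel_to_flow (Y : flow G) (y0 : Y) : exists phi : ambient -> Y,
  forall xi, samuel xi -> forall (F : Y -> R) f, continuous F ->
    (forall g, f g = F (act g y0)) -> F (phi xi) = xi f.
Proof.
suff /choice [phi phiP] (xi : ambient) : exists y : Y, samuel xi ->
    forall (F : Y -> R) f, continuous F ->
    (forall g, f g = F (act g y0)) -> F y = xi f.
  by exists phi.
have [Sxi|nS] := pselect (samuel xi); last by exists y0.
pose B : set_system Y := filter_from (nbhs xi)
  (fun U => [set act g y0 | g in [set g | U (samuel_of g)]]).
have FB : Filter B.
  apply: filter_from_filter; first by exists setT; exact: filterT.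
  move=> U V nU nV; exists (U `&` V); first exact: filterI.
  by move=> _ [g [Ug Vg] <-]; split; exists g.
have PB : ProperFilter B.
  apply: filter_from_proper => U nU.
  have [_ [[g _ <-] Ug]] := Sxi _ nU.
  by exists (act g y0); exists g.
have [|y [_ cy]] := @flow_compact G Y B PB; first exact: filterT.
exists y => _ F f Fc fF; apply/eqP; rewrite -subr_eq0 -normr_le0.
apply/ler_addgt0Pr => e e0; rewrite add0r.
have e2 : 0 < e / 2 by rewrite divr_gt0.
have /cvgrPdist_le /(_ _ e2) nF := Fc y.
have /cvgrPdist_le /(_ _ e2) nxi := @ambient_ev_continuous R G f xi.
have nB : B [set act g y0 | g in [set g | `|xi f - samuel_of g f| <= e / 2]].
  by exists [set t : ambient | `|xi f - t f| <= e / 2].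
have [_ [[g Ug <-] Fg]] := cy _ _ nB nF.
rewrite [e]splitr; apply: (le_trans (ler_distD (F (act g y0)) _ _)).
by apply: lerD => //; rewrite distrC -fF.
Qed.

(** The extended orbit map of any point of Y, restricted to M, is a map of
    flows. Its image is closed and invariant, so it is Y by minimality. *)
Lemma universal_flow_of_subflow M (mM : minimal_subflow M) :
  universal_minimal_flow (flow_of_subflow mM.1).
Proof.
split; first exact: minimal_flow_of_subflow.
move=> Y mY; have [y0 _] := @flow_nonempty G Y.
have [phi phiP] := samuel_to_flow y0.
have [[clM [xi0 Mxi0] MS MG] minM] := mM.
pose p (x : flow_of_subflow mM.1) : Y := phi (set_val (x : set_type M)).
have pS (x : flow_of_subflow mM.1) : samuel (set_val (x : set_type M)).
  by apply: MS; exact: set_valP.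
have pc : continuous p.
  move=> x U nU.
  have [F [Fc F01 F0 FU]] := compact_urysohn R (@flow_compact G Y) (@flow_hausdorff G Y) nU.
  have [f fF] := orbit_ruc y0 Fc F01.
  have xf0 : set_val (x : set_type M) f = 0 by rewrite -(phiP _ (pS x) F).
  have c : continuous (fun x' : set_type M => set_val x' f : R).
    move=> y; apply: (@continuous_comp _ ambient _ set_val (fun xi => xi f)).
      exact: initial_continuous.
    exact: ambient_ev_continuous.
  have : \forall x' \near (x : set_type M), set_val x' f < 1.
    apply: (c x [set r : R | r < 1]) => /=; rewrite xf0.
    by apply: open_nbhs_nbhs; split; [exact: open_lt | exact: ltr01].
  by apply: filterS => x' x'f; apply: FU; rewrite (phiP _ (pS x') F f).
have pG g x : p (act g x) = act g (p x).
  apply: (@flow_hausdorff G Y) => U V nU /nbhs_singleton Vy.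
  exists (act g (p x)); split=> //.
  have [F [Fc F01 F0 FU]] := compact_urysohn R (@flow_compact G Y) (@flow_hausdorff G Y) nU.
  have [f fF] := orbit_ruc y0 Fc F01.
  apply: FU; suff -> : F (act g (p x)) = F (p (act g x)) by rewrite F0 ltr01.
  rewrite (phiP _ (pS _) F f) // /samuel_act.
  rewrite (phiP _ (pS x) (fun y => F (act g y)) (ruc_shift_fun g f)) //.
    move=> y; apply: (@continuous_comp _ _ _ (fun y : Y => act g y) F); last exact: Fc.
    exact: (@act_continuousr G Y g).
  by move=> h /=; rewrite fF actM.
exists p; split=> // y.
have clp : closed (range p).
  apply: compact_closed; first exact: flow_hausdorff.
  apply: continuous_compact; last exact: flow_compact.
  by apply: continuous_subspaceT.
apply: contrapT => ny.
have [||z [nz [g _ gz]]] := mY (p (subflow_point Mxi0)) (~` range p).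
- by exists y => -[x _ xy]; apply: ny; exists x.
- by rewrite openC.
by apply: nz; rewrite -gz; exists (act g (subflow_point Mxi0 : flow_of_subflow mM.1)).
Qed.

End Universality.

(** * From a coloring bound to metrizable minimal flows *)

Section ColorBound.
Context {G : topGroupType}.

(** The form taken in the group by a bound k on the approximate Ramsey degree:
    V stands for the enlargement by 1, right translation by g for the
    precomposition with an element of Epi(C, B), and E for Epi(B, A). *)
Definition color_bound (D V : set G) (k : nat) : Prop :=
  forall (E : seq G) (d : nat) (chi : G -> 'I_d), (forall a, a \in E -> D a) ->
  exists (g : G) (I : {set 'I_d}), [/\ D g, (#|I| <= k)%N &
    forall a, a \in E -> exists v c,
      [/\ V v, D c, (a * g)%g = (v * c)%g & chi c \in I]].

Section MinimalFlow.
Variables (D : set G) (Y : flow G).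
Hypothesis dD : dense D.
Hypothesis mY : minimal_flow Y.

(** Closeness at scale V. The errors V V^-1, rather than V, make the relation
    symmetric and compare two points reached from a common one by errors in V. *)
Definition close_by (V : set G) : set (Y * Y) :=
  closure [set xy | exists v w : G, [/\ V v, V w & xy.2 = act (v * w^-1)%g xy.1]].

Lemma close_by_sym (V : set G) (x y : Y) : close_by V (x, y) -> close_by V (y, x).
Proof.
move=> xy N [[B A] /= [nB nA] BAN].
have [|[a b] [[v [w [Vv Vw /= bE]]] [/= Aa Bb]]] := xy (A `*` B).
  by exists (A, B).
exists (b, a); split; last exact: BAN.
by exists w, v; split=> //=; rewrite bE -actM mulgA mulgVK mulgV act1.
Qed.

(** By minimality each point is sent into U by some element of the dense set D;
    by compactness finitely many elements suffice for all points. *)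
Lemma finite_return (y : Y) (U : set Y) : nbhs y U ->
  exists2 E : seq G, (forall a, a \in E -> D a) &
    forall z : Y, exists2 a, a \in E & U (act a z).
Proof.
move=> nU.
(* The filter of large finite subsets of G. *)
pose F : set_system (seq G) :=
  filter_from setT (fun E0 : seq G => [set E : seq G | {subset E0 <= E}]).
have FF : Filter F.
  apply: filter_from_filter; first by exists [::].
  move=> A B _ _; exists (A ++ B) => // E ABE.
  by split=> a aA; apply: ABE; rewrite mem_cat aA ?orbT.
have PF : ProperFilter F by apply: filter_from_proper => E _; exists E.
pose P (E : seq G) (z : Y) := exists a, [/\ a \in E, D a & U (act a z)].
have : \forall E \near F, [set: Y] `<=` P E.
  have /compact_near_coveringP cY := @flow_compact G Y.
  apply: cY => z _.
  have [||z1 [Uz [g _ gz]]] := @mY z U°.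
  - by exists y; exact: nU.
  - exact: open_interior.
  have [||a [Ua Da]] := @dD ((fun g : G => act g z) @^-1` U°).
  - by exists g; rewrite /preimage /= gz.
  - by apply: open_comp; [move=> ? _; exact: act_continuousl | exact: open_interior].
  exists (act a @^-1` U°, [set E : seq G | {subset [:: a] <= E}]).
    split=> /=; last by exists [:: a].
    apply: (@act_continuousr G Y a z); apply: open_nbhs_nbhs; split=> //.
    exact: open_interior.
  move=> [z' E] [/= Uz' aE]; exists a; split=> //; first by apply: aE; rewrite inE.
  exact: interior_subset.
move=> /(@filter_ex _ F) [E EP].
exists [seq a <- E | `[< D a >]] => [a|z]; first by rewrite mem_filter => /andP [/asboolP].
have [a [aE Da Ua]] := EP z I; exists a => //.
by rewrite mem_filter aE andbT; exact/asboolP.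
Qed.

(** If k + 1 points were pairwise far, they would have neighborhoods U i so far
    apart that the sets T i of those c which an error in V sends into U i along
    the orbit of p would be disjoint. Color c by the index of its set. A finite
    set returning every point to every U i has translates meeting all T i, so
    none of them is contained, up to errors in V, in k color classes. *)
Lemma color_bound_close (V : set G) (k : nat) (y : 'I_k.+1 -> Y) :
  color_bound D V k -> exists i j, i != j /\ close_by V (y i, y j).
Proof.
move=> DVk; apply: contrapT => far.
have /choice [AB ABP] (ij : 'I_k.+1 * 'I_k.+1) : exists AB : set Y * set Y,
    [/\ nbhs (y ij.1) AB.1, nbhs (y ij.2) AB.2 & ij.1 != ij.2 ->
      forall z v w, AB.1 z -> V v -> V w -> ~ AB.2 (act (v * w^-1)%g z)].
  have [->|ij12] := eqVneq ij.1 ij.2.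
    by exists (setT, setT); split=> //; exact: filterT.
  have /existsNP [C /not_implyP [[[A B] /= [nA nB] ABC] CN]] :
    ~ close_by V (y ij.1, y ij.2) by move=> nij; apply: far; exists ij.1, ij.2.
  exists (A, B); split=> // _ z v w Az Vv Vw Bz; apply: CN.
  by exists (z, act (v * w^-1)%g z); split; [exists v, w|apply: ABC].
pose U i := [set z | forall j, j \in enum 'I_k.+1 -> (AB (i, j)).1 z /\ (AB (j, i)).2 z].
have nU i : nbhs (y i) (U i).
  apply: near_seq => j _; apply: filterI.
    by have [] := ABP (i, j).
  by have [] := ABP (j, i).
have U_far i j z v w : U i z -> V v -> V w -> U j (act (v * w^-1)%g z) -> i = j.
  move=> Uz Vv Vw Uz'; apply/eqP; apply: contraT => ij.
  have [_ _ /(_ ij)] := ABP (i, j).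
  move=> /(_ z v w (Uz j (mem_enum _ _)).1 Vv Vw) [].
  exact: (Uz' i (mem_enum _ _)).2.
have /choice [E EP] i : exists E : seq G, (forall a, a \in E -> D a) /\
    forall z : Y, exists2 a, a \in E & U i (act a z).
  by have [E] := finite_return (nU i); exists E.
pose p := y ord0.
pose T i c := exists2 v, V v & U i (act (v * c)%g p).
have T_inj i j c : T i c -> T j c -> i = j.
  move=> [v Vv Ui] [w Vw Uj]; apply: U_far Ui Vw Vv _.
  by rewrite -actM mulgA mulgVK.
(* The color ord0 is left to the elements outside all T i. *)
pose chi c : 'I_k.+2 :=
  if [pick i | `[< T i c >]] is Some i then lift ord0 i else ord0.
have chiE i c : T i c -> chi c = lift ord0 i.
  move=> Tic; rewrite /chi; case: pickP => [j /asboolP Tjc|/(_ i)/asboolP//].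
  by rewrite (T_inj _ _ _ Tic Tjc).
have [a|g [I [Dg Ik gI]]] := DVk (flatten [seq E i | i <- enum 'I_k.+1]) _ chi.
  by move=> /flatten_mapP [i _]; exact: (EP i).1.
have : (#|[set lift ord0 i | i : 'I_k.+1]| <= #|I|)%N.
  apply: subset_leq_card; apply/fintype.subsetP => _ /imsetP [i _ ->].
  have [a aE Ua] := (EP i).2 (act g p).
  have [|v [c [Vv Dc agE chic]]] := gI a.
    by apply/flatten_mapP; exists i; rewrite ?mem_enum.
  by rewrite -(chiE i c) //; exists v => //; rewrite -agE actM.
rewrite card_imset; last exact: lift_inj.
by rewrite card_ord ltnNge Ik.
Qed.

End MinimalFlow.
End ColorBound.

Section MinimalFlowMetrizable.
Context {R : realType} {G : topGroupType}.
Variables (D : set G) (Y : flow G).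
Hypotheses (dD : dense D) (mY : minimal_flow Y).

Lemma color_bound_net V k : color_bound D V k ->
  exists s : seq Y, forall y, exists2 x, x \in s & close_by V (x, y).
Proof.
move=> DVk; apply: contrapT => /forallNP nonet.
have [|y yfar] := @infinite_apart Y (fun x y => close_by V (x, y)).
  move=> s; have /existsNP [y ny] := nonet s; exists y => x xs xy.
  by apply: ny; exists x.
have [i [j [ij yij]]] :=
  color_bound_close dD mY (fun i : 'I_k.+1 => y i) DVk.
have [ji|ji|ijE] := ltngtP i j.
- exact: (yfar _ _ ji).
- by apply: (yfar _ _ ji); exact: close_by_sym.
- by move: ij; rewrite (val_inj ijE) eqxx.
Qed.

(** The graphs of small elements of G accumulate only on the diagonal. *)
Lemma close_by_small (p : Y) (O : set Y) : nbhs p O -> exists U P,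
  [/\ nbhs p U, nbhs (1%g : G) P & forall V, V `<=` P ->
    forall x y, U x -> close_by V (x, y) -> O y].
Proof.
move=> nO.
have [C nC CO] : exists2 C, nbhs p C & closure C `<=` O.
  exact: (@compact_regular Y p setT (@flow_hausdorff G Y) (@flow_compact G Y) filterT O nO).
have : nbhs (1%g : G, p) [set gt : G * Y | C (act gt.1 gt.2)].
  by apply: (@act_continuous G Y (1%g, p) C); rewrite /= act1.
move=> [[P U] /= [nP nU] PU].
have [Q [nQ QV Q4]] := symmetric_nbhs1 nP.
exists U°, Q; split=> //; first by apply: open_nbhs_nbhs; split=> //; exact: open_interior.
move=> V VQ x y Ux xy; apply: CO => B nB.
have [|[a b] [[v [w [Vv Vw /= bE]]] [/= /interior_subset Ua Bb]]] := xy (U° `*` B).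
  by exists (U°, B) => //; split=> //; apply: open_nbhs_nbhs; split=> //; exact: open_interior.
exists b; split=> //; rewrite bE; apply: (PU (_, a)); split=> //=.
have Q1 := nbhs_singleton nQ.
by have := Q4 _ _ _ _ (VQ _ Vv) (QV _ (VQ _ Vw)) Q1 Q1; rewrite !mulg1.
Qed.

(** A net s n at the scale V n gives finitely many closed sets B n x covering Y.
    Two points are related by W n when they lie in two of these sets that meet.
    A single set would not do: near y the space is covered by the sets
    containing y, but two points near y may lie in different ones. Points
    related by every W n are equal because a chain of boundedly many points,
    consecutive ones being close at smaller and smaller scales, shrinks to a
    point ([tends_close]). *)
Lemma minimal_flow_metrizable (V : nat -> set G) :
  (forall n, nbhs (1%g : G) (V n)) ->
  (forall U, nbhs (1%g : G) U -> exists n, forall m, (n <= m)%N -> V m `<=` U) ->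
  (forall n, exists k, color_bound D (V n) k) -> metrizable R Y.
Proof.
move=> nV Vbase Vk.
have /choice [s sP] n : exists s : seq Y,
    forall y, exists2 x, x \in s & close_by (V n) (x, y).
  by have [k /color_bound_net] := Vk n.
pose B n (x : Y) := [set y | close_by (V n) (x, y)].
have clB n x : closed (B n x).
  apply: closed_preimage; last exact: closed_closure.
  by move=> y; apply: cvg_pair; [exact: cvg_cst | exact: cvg_id].
have nB n x y : ~ B n x y -> \forall z \near y, ~ B n x z.
  move=> nBy; apply: (@open_nbhs_nbhs Y y (~` B n x)); split=> //.
  by rewrite openC.
pose meet n (xx : Y * Y) := exists y, B n xx.1 y /\ B n xx.2 y.
pose W n : set (Y * Y) := [set yz | exists xx, [/\
  xx \in [seq (a, b) | a <- s n, b <- s n], meet n xx, B n xx.1 yz.1 & B n xx.2 yz.2]].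
apply: (@compact_metrizable R Y (@flow_compact G Y) (@flow_hausdorff G Y) W).
- move=> n; rewrite -openC openE => -[y z] nW.
  have : \forall p \near ((y, z) : Y * Y),
      forall xx, xx \in [seq (a, b) | a <- s n, b <- s n] ->
      ~ [/\ meet n xx, B n xx.1 p.1 & B n xx.2 p.2].
    apply: (@near_seq _ _ (nbhs ((y, z) : Y * Y)) _ (fun xx (p : Y * Y) =>
      ~ [/\ meet n xx, B n xx.1 p.1 & B n xx.2 p.2])) => xx xxs.
    have [mx|nmx] := pselect (meet n xx); last by apply: nearW => p [].
    have [By|nBy] := pselect (B n xx.1 y); last first.
      exists ([set y' | ~ B n xx.1 y'], setT); first by split; [exact: nB|exact: filterT].
      by move=> [a b] [/= na _] [].
    have nBz : ~ B n xx.2 z by move=> Bz; apply: nW; exists xx.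
    exists (setT, [set y' | ~ B n xx.2 y']); first by split; [exact: filterT|exact: nB].
    by move=> [a b] [/= _ nb] [].
  by apply: filterS => p np [xx [xs mx Bx1 Bx2]]; apply: (np xx).
- move=> n y; pose S := [set z | forall x, x \in s n -> (B n x z -> B n x y)].
  have nS : nbhs y S.
    apply: near_seq => x xs; have [By|nBy] := pselect (B n x y); first exact: nearW.
    by apply: filterS (nB _ _ _ nBy) => z.
  exists (S, S) => // -[z z'] [/= Sz Sz'].
  have [x xs Bxz] := sP n z; have [x' xs' Bxz'] := sP n z'.
  exists (x, x'); split=> //=; first by apply/allpairsP; exists (x, x').
  by exists y; split; [exact: Sz|exact: Sz'].
- move=> y z yz.
  pose tends (t : nat -> Y) := forall O, nbhs y O ->
    exists N, forall n, (N <= n)%N -> O (t n).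
  have tends_close t t' : tends t -> (forall n, close_by (V n) (t n, t' n)) -> tends t'.
    move=> ty tt' O /close_by_small [U [P [nU nP UP]]].
    have [N1 N1U] := ty U nU; have [N2 N2P] := Vbase P nP.
    exists (maxn N1 N2) => n; rewrite geq_max => /andP [/N1U Un /N2P VnP].
    exact: (UP _ VnP _ _ Un (tt' n)).
  have /choice [x xP] n : exists x,
      [/\ B n x.1 y, B n x.1 x.2.2, B n x.2.1 x.2.2 & B n x.2.1 z].
    by have [[a b] [_ [c [ac bc]] ay bz]] := yz n; exists (a, (b, c)).
  have tz : tends (fun=> z).
    apply: (@tends_close (fun n => (x n).2.1)); last by move=> n; have [] := xP n.
    apply: (@tends_close (fun n => (x n).2.2)); last first.
      by move=> n; apply: close_by_sym; have [] := xP n.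
    apply: (@tends_close (fun n => (x n).1)); last by move=> n; have [] := xP n.
    apply: (@tends_close (fun=> y)).
      by move=> O /nbhs_singleton Oy; exists 0%N.
    by move=> n; apply: close_by_sym; have [] := xP n.
  apply: (@flow_hausdorff G Y) => A C nA /nbhs_singleton Cz; exists z; split=> //.
  by have [N NA] := tz A nA; exact: (NA N).
Qed.

End MinimalFlowMetrizable.

(** * From a metrizable universal minimal flow to a coloring bound *)

Section Converse.
Context {R : realType} {G : topGroupType}.
Local Notation ambient := (@samuel_ambient R G).
Local Notation samuel := (@samuel R G).
Implicit Types (f : @ruc_fun R G) (xi eta : ambient) (g h : G) (V A B : set G).

(** Apartness in S(G) at scale V is tested on the traces on G of neighborhoods,
    where it can be witnessed by right uniformly continuous functions. *)
Definition apart V xi eta : Prop := exists U U' : set ambient,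
  [/\ nbhs xi U, nbhs eta U' & forall g h v,
    U (samuel_of g) -> U' (samuel_of h) -> V v -> h <> (v * g)%g].

Lemma samuel_urysohn V A : nbhs (1%g : G) V -> exists f,
  (forall g, A g -> f g = 1) /\
  forall g, f g != 0 -> exists v a, [/\ V v, A a & g = (v * a)%g].
Proof.
by move=> /(@ruc_urysohn R G V A) [f [fr f1 f0]]; exists (RucFun fr).
Qed.

Lemma nbhs_ev xi f (P : set R) : nbhs (xi f) P -> nbhs xi [set eta : ambient | P (eta f)].
Proof. exact: ambient_ev_continuous. Qed.

Lemma nbhs_ev_neq xi f (r : R) : xi f <> r -> nbhs xi [set eta : ambient | eta f <> r].
Proof.
move=> xr; apply: (@nbhs_ev xi f [set t | t <> r]).
have := @open_nbhs_nbhs R (xi f) (~` [set r]); apply.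
split=> //; rewrite openC; exact: closed_eq.
Qed.

Lemma samuel_ev_eq xi (U : set ambient) f (r : R) : samuel xi -> nbhs xi U ->
  (forall g, U (samuel_of g) -> f g = r) -> xi f = r.
Proof.
move=> Sxi nU fr; apply: contrapT => /nbhs_ev_neq nr.
have [_ [[g _ <-] [nfr Ug]]] := Sxi _ (filterI nr nU).
by apply: nfr; exact: fr.
Qed.

(** A substitute for the triangle inequality. The functions equal to 1 on the
    traces of V0 U and V0 U', and 0 outside V0 V0 U and V0 V0 U', have product 0
    on G, hence at zeta. So one of them vanishes at zeta, and separates zeta from
    xi or from eta. *)
Lemma apart_shrink V V0 xi eta zeta : nbhs (1%g : G) V0 ->
  (forall u, V0 u -> V0 (u^-1)%g) ->
  (forall a b c d, V0 a -> V0 b -> V0 c -> V0 d -> V (a * b * c * d)%g) ->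
  samuel xi -> samuel eta -> samuel zeta ->
  apart V xi eta -> apart V0 xi zeta \/ apart V0 eta zeta.
Proof.
move=> nV0 V0V V04 Sxi Seta Szeta [U [U' [nU nU' UU']]].
pose A (W : set ambient) := [set g | exists v a, [/\ V0 v, W (samuel_of a) & g = (v * a)%g]].
have [f [f1 f0]] := samuel_urysohn (A U) nV0.
have [f' [f'1 f'0]] := samuel_urysohn (A U') nV0.
have ff'0 : zeta f * zeta f' = 0.
  suff : [set x : ambient | x f * x f' = 0] zeta by [].
  move: zeta Szeta; apply: samuel_closed_ind.
    apply: (@closed_preimage _ _ (fun x : ambient => x f * x f' : R) [set 0]).
      by move=> x; apply: (@continuousM _ _ (fun x : ambient => x f : R)
        (fun x : ambient => x f' : R)); exact: ambient_ev_continuous.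
    exact: closed_eq.
  move=> g /=; apply/eqP; rewrite mulf_eq0; apply/negPn/negP; rewrite negb_or.
  move=> /andP [/f0 [v [_ [Vv [w [a [Vw Ua ->]]] gE]]] /f'0 [v' [_ [Vv' [w' [b [Vw' Ub ->]]] gE']]]].
  apply: (UU' _ _ _ Ua Ub (V04 _ _ _ _ (V0V _ Vw') (V0V _ Vv') Vv Vw)).
  by rewrite -!mulgA -gE gE' mulKg mulKg.
have half (x : ambient) (W : set ambient) (k : @ruc_fun R G) : samuel x -> nbhs x W ->
    (forall g, A W g -> k g = 1) -> zeta k = 0 -> apart V0 x zeta.
  move=> Sx nW k1 k0; exists W, [set t : ambient | t k <> 1]; split=> //.
    by apply: nbhs_ev_neq; rewrite k0 => /eqP; rewrite eq_sym oner_eq0.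
  by move=> g h v Wg kh Vv hE; apply: kh; apply: k1; exists v, g.
move/eqP : ff'0; rewrite mulf_eq0 => /orP [|] /eqP z0; [left|right].
  exact: half f1 z0.
exact: half f'1 z0.
Qed.

(** The analogue of the absence of nontrivial convergent sequences in the
    Stone-Cech compactification of the integers. By [apart_shrink] all terms
    but at most one are apart from the limit at a smaller scale. A subsequence then has
    neighborhoods W j with pairwise apart traces, and a right uniformly
    continuous function that is 1 on the even traces and 0 on the odd ones
    has no limit along it. *)
Lemma apart_seq_not_convergent V (x : nat -> ambient) zeta :
  nbhs (1%g : G) V -> (forall n, samuel (x n)) -> samuel zeta ->
  (forall U, nbhs zeta U -> exists N, forall n, (N <= n)%N -> U (x n)) ->
  (forall m n, (m < n)%N -> apart V (x m) (x n)) -> False.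
Proof.
move=> nV Sx Sz xz xapart.
have [V0 [nV0 V0V V04]] := symmetric_nbhs1 nV.
have [N zN] : exists N, forall n, (N <= n)%N -> apart V0 (x n) zeta.
  have [ok|/existsNP [n0 bad]] := pselect (forall n, apart V0 (x n) zeta).
    by exists 0%N.
  exists n0.+1 => n /xapart n0n.
  by have [/bad|//] := apart_shrink nV0 V0V V04 (Sx n0) (Sx n) Sz n0n.
have /choice [UU' UU'P] n : exists UU' : set ambient * set ambient,
    (N <= n)%N -> [/\ nbhs (x n) UU'.1, nbhs zeta UU'.2 & forall g h v,
    UU'.1 (samuel_of g) -> UU'.2 (samuel_of h) -> V0 v -> h <> (v * g)%g].
  have [Nn|_] := leqP N n; last by exists (setT, setT).
  by have [U [U' ?]] := zN n Nn; exists (U, U').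
(* From the index b n on, the sequence stays in the neighborhood of zeta that
   is apart from x n; the next index of the subsequence is taken beyond it. *)
have /choice [b bP] n : exists b, (N <= n)%N ->
    forall m, (b <= m)%N -> (UU' n).2° (x m).
  have [Nn|_] := leqP N n; last by exists 0%N.
  by have [_ /nbhs_interior /xz [b bP] _] := UU'P n Nn; exists b.
pose k := fix k j := if j is j'.+1 then maxn (k j').+1 (b (k j')) else N.
have kS j : (k j < k j.+1)%N by rewrite /= leq_max leqnn.
have kmono : {homo k : i j / (i < j)%N} by apply: homo_ltn => //; exact: ltn_trans.
have Nk j : (N <= k j)%N.
  by elim: j => // j IH; exact: leq_trans IH (ltnW (kS j)).
have kmon i j : (i < j)%N -> (b (k i) <= k j)%N.
  move=> ij; have bS : (b (k i) <= k i.+1)%N by rewrite /= leq_max leqnn orbT.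
  apply: leq_trans bS _; move: ij; rewrite leq_eqVlt => /predU1P [->//|/kmono/ltnW//].
pose W j : set ambient := [set t | (UU' (k j)).1 t /\
  forall i, i \in iota 0 j -> (UU' (k i)).2 t].
have nW j : nbhs (x (k j)) (W j).
  apply: filterI; first by have [] := UU'P (k j) (Nk j).
  apply: (@near_seq _ _ (nbhs (x (k j))) _ (fun i t => (UU' (k i)).2 t)) => i.
  rewrite mem_iota add0n => /andP [_ ij].
  exact: bP (Nk i) _ (kmon _ _ ij).
pose T := [set g | exists2 j, ~~ odd j & W j (samuel_of g)].
have [f [f1 f0]] := samuel_urysohn T nV0.
have far i j g h v : (i < j)%N -> W i (samuel_of g) -> W j (samuel_of h) ->
    V0 v -> h <> (v * g)%g.
  move=> ij [Uig _] [_ U'jh]; have [_ _] := UU'P (k i) (Nk i); apply=> //.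
  by apply: U'jh; rewrite mem_iota.
have x_even j : ~~ odd j -> x (k j) f = 1.
  by move=> oj; apply: samuel_ev_eq (nW j) _ => // g Wg; apply: f1; exists j.
have x_odd j : odd j -> x (k j) f = 0.
  move=> oj; apply: samuel_ev_eq (nW j) _ => // g Wg; apply/eqP.
  apply: contraT => /f0 [v [t [Vv [i oi Wt] gE]]].
  have [ij|ji|ij] := ltngtP i j.
  - by case: (far _ _ _ _ _ ij Wt Wg Vv).
  - case: (far _ _ _ _ _ ji Wg Wt (V0V _ Vv)).
    by rewrite gE mulKg.
  - by move: oi; rewrite ij oj.
have h2 : (0 : R) < 2^-1 by rewrite invr_gt0.
have /cvgrPdist_lt /(_ _ h2) /xz [n nP] := @ambient_ev_continuous R G f zeta.
have kn j : (j <= k j)%N by elim: j => // j IH; exact: leq_ltn_trans IH (kS j).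
have nn : (n <= n.*2)%N by rewrite -addnn leq_addr.
have z1 : `|zeta f - x (k n.*2) f| < 2^-1.
  exact: (nP (k n.*2) (leq_trans nn (kn _))).
have z0 : `|zeta f - x (k n.*2.+1) f| < 2^-1.
  exact: (nP (k n.*2.+1) (leq_trans (leqW nn) (kn _))).
rewrite x_even ?odd_double // in z1; rewrite x_odd ?oddS ?odd_double // in z0.
have := le_lt_trans (ler_distD (zeta f) 1 0) (ltrD _ z0).
rewrite subr0 normr1 distrC => /(_ _ z1).
by rewrite -div1r -splitr ltxx.
Qed.

End Converse.

Section ColorBoundOfMetrizable.
Context {R : realType} {G : topGroupType}.
Local Notation ambient := (@samuel_ambient R G).
Local Notation samuel := (@samuel R G).
Implicit Types (f : @ruc_fun R G) (xi eta : ambient) (g h : G).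
Variables (M : set ambient) (mM : minimal_subflow M).
Variables (Z : flow G) (uZ : universal_minimal_flow Z) (metZ : metrizable R Z).

Let MS xi : M xi -> samuel xi.
Proof. by case: mM => -[_ _ + _] _; apply. Qed.

(** Sequential compactness passes from a metrizable universal minimal flow to
    its continuous image M. *)
Lemma subflow_subsequence (x : nat -> set_type M) :
  exists2 zeta, M zeta & exists k : nat -> nat, {homo k : i j / (i < j)%N} /\
    forall U, nbhs zeta U -> exists N, forall n, (N <= n)%N -> U (set_val (x (k n))).
Proof.
have [_ /(_ (flow_of_subflow mM.1))] := uZ.
case; first exact: minimal_flow_of_subflow.
move=> p [pc _ psurj].
have /choice [y yx] n : exists y, p y = x n by exact: psurj.
have [z [k [kmono yz]]] := metrizable_subsequence y (@flow_compact G Z) metZ.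
exists (set_val (p z : set_type M)); first exact: set_valP.
exists k; split=> // U nU.
have c : continuous (fun t : Z => set_val (p t : set_type M) : ambient).
  move=> t; apply: (@continuous_comp _ (set_type M) _ p set_val); first exact: pc.
  exact: initial_continuous.
have [N NU] := yz _ (c z _ nU); exists N => n /NU; rewrite /preimage /=.
by rewrite yx.
Qed.

Lemma apart_net (V : set G) : nbhs (1%g : G) V -> exists s : seq ambient,
  (forall eta, eta \in s -> M eta) /\
  forall xi, M xi -> exists2 eta, eta \in s & ~ apart V eta xi.
Proof.
move=> nV; apply: contrapT => /forallNP nonet.
have [|x xapart] := @infinite_apart (set_type M)
    (fun x y => ~ apart V (set_val x) (set_val y)).
  move=> s; have /not_andP [|] := nonet [seq set_val x | x <- s].
    by case=> eta /mapP [x _ ->]; exact: set_valP.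
  move=> /existsNP [xi /not_implyP [Mxi nxi]].
  exists (SigSub (mem_set Mxi)) => x xs xxi; apply: nxi.
  by exists (set_val x) => //; exact: map_f.
have [zeta Mz [k [kmono xz]]] := subflow_subsequence x.
apply: (@apart_seq_not_convergent R G V (fun n => set_val (x (k n))) zeta) => //.
- by move=> n; apply: MS; exact: set_valP.
- exact: MS.
- by move=> m n /kmono /xapart /contrapT.
Qed.

(** Each point eta of a finite net of M is in the closure of the class of some
    color idx eta. Any point of M is close to a point of the net, so at that
    point one of the functions f (idx eta), which are supported in V S (idx eta),
    takes the value 1. Applied to the points a xi for a in E, where xi is a fixed
    point of M, this makes the corresponding functions nonzero at a g for every
    g in D that is close enough to xi. *)
Lemma color_bound_of_metrizable (D V : set G) : dense D -> nbhs (1%g : G) V ->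
  exists k, color_bound D V k.
Proof.
move=> dD nV; have [V0 [nV0 V0V V04]] := symmetric_nbhs1 nV.
have V01 := nbhs_singleton nV0.
have [s [sM sP]] := apart_net nV0; exists (size s) => E d chi ED.
pose S i := [set c | D c /\ chi c = i].
have /choice [idx idxP] (eta : ambient) : exists i, samuel eta ->
    forall U, nbhs eta U -> exists2 c, S i c & U (samuel_of c).
  have [Seta|] := pselect (samuel eta); last by exists (chi 1%g).
  apply: contrapT => /forallNP bad.
  have /choice [U UP] i : exists U, nbhs eta U /\ forall c, S i c -> ~ U (samuel_of c).
    have /not_implyP [_ /existsNP [U /not_implyP [nU UP]]] := bad i.
    by exists U; split=> // c Sc Uc; apply: UP; exists c.
  have : \forall t \near eta, forall i, i \in enum 'I_d -> U i t.
    by apply: (@near_seq _ _ (nbhs eta) _ U) => i _; have [] := UP i.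
  move=> /(samuel_approx dD Seta) [c Dc /(_ (chi c) (mem_enum _ _))].
  by apply: (UP (chi c)).2.
have /choice [f fP] i : exists f,
    (forall g, (exists v w c, [/\ V0 v, V0 w, S i c & g = (v * w * c)%g]) -> f g = 1) /\
    (forall g, f g != 0 -> exists v c, [/\ V v, S i c & g = (v * c)%g]).
  have [f [f1 f0]] := @samuel_urysohn R G V0
    [set g | exists v w c, [/\ V0 v, V0 w, S i c & g = (v * w * c)%g]] nV0.
  exists f; split=> // g /f0 [u [_ [Vu [v [w [c [Vv Vw Sc ->]]]] ->]]].
  exists (u * v * w * 1)%g, c; split=> //; first exact: V04.
  by rewrite mulg1 !mulgA.
pose I := [set i in [seq idx eta | eta <- s]].
have MI xi : M xi -> exists2 i, i \in I & xi (f i) = 1.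
  move=> Mxi; have [eta etas near] := sP _ Mxi.
  exists (idx eta); first by rewrite inE; exact: map_f.
  apply: contrapT => /nbhs_ev_neq nxi; apply: near.
  have Seta : samuel eta by apply: MS; exact: sM.
  have [k [k1 k0]] := @samuel_urysohn R G V0 (S (idx eta)) nV0.
  have etak : eta k = 1.
    apply: contrapT => /nbhs_ev_neq /(idxP _ Seta) [c Sc].
    by apply; exact: k1.
  exists [set t : ambient | t k <> 0], [set t : ambient | t (f (idx eta)) <> 1]; split=> //.
    by apply: nbhs_ev_neq; rewrite etak => /eqP; rewrite oner_eq0.
  move=> g h v /eqP /k0 [w [c [Vw Sc ->]]] fh Vv hE; apply: fh.
  by apply: (fP (idx eta)).1; exists v, w, c; rewrite hE mulgA.
have [[_ [xi Mxi] _ MG] _] := mM.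
have /choice [ia iaP] (a : G) : exists i, i \in I /\ samuel_act a xi (f i) = 1.
  by have [i iI] := MI _ (MG a _ Mxi); exists i.
have : \forall t \near xi, forall a, a \in E -> samuel_act a t (f (ia a)) <> 0.
  apply: (@near_seq _ _ (nbhs xi) _ (fun a t => samuel_act a t (f (ia a)) <> 0)) => a _.
  apply: (@samuel_act_continuous R G a xi [set t : ambient | t (f (ia a)) <> 0]); apply: nbhs_ev_neq.
  by rewrite (iaP a).2 => /eqP; rewrite oner_eq0.
move=> /(samuel_approx dD (MS Mxi)) [g Dg gE].
exists g, I; split=> //.
  rewrite cardsE; apply: leq_trans (card_size _) _.
  by rewrite size_map.
move=> a aE; have /eqP /(fP (ia a)).2 [v [c [Vv [Dc chic] agE]]] := gE a aE.
by exists v, c; split=> //; rewrite chic; exact: (iaP a).1.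
Qed.

End ColorBoundOfMetrizable.

Theorem metrizable_umf_iff_color_bound (R : realType) (G : topGroupType)
    (D : set G) (V : nat -> set G) :
  dense D -> (forall n, nbhs (1%g : G) (V n)) ->
  (forall U, nbhs (1%g : G) U -> exists n, forall m, (n <= m)%N -> V m `<=` U) ->
  (exists M : flow G, universal_minimal_flow M /\ metrizable R M) <->
  (forall U, nbhs (1%g : G) U -> exists k, color_bound D U k).
Proof.
move=> dD nV Vbase; have [M mM] := @minimal_subflow_exists R G; split.
  by move=> [Z [uZ metZ]] U nU; exact: (color_bound_of_metrizable mM uZ metZ).
move=> Uk; exists (flow_of_subflow mM.1); split.
  exact: universal_flow_of_subflow.
apply: (minimal_flow_metrizable dD _ nV Vbase); first exact: minimal_flow_of_subflow.
by move=> n; exact: Uk.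
Qed.

(** * Homogeneity of projective Fraisse limits *)

Section Cylinders.
Context {L : language} {F : proj_fraisse L} {X : omega_obj F}.
Implicit Types A B : structure L.

Definition factors A (m : nat) (e : omega_lim X -> A) : Prop :=
  exists2 phi : level X m -> A, mor F phi & e = phi \o lproj m.

(** The maps from the limit to A that depend on finitely many levels. They are
    the morphisms to the constant sequence of A, seen as maps into A. *)
Definition cyl A (e : omega_lim X -> A) : Prop := exists m, factors m e.

Lemma factors_le A m n (e : omega_lim X -> A) :
  (m <= n)%N -> factors m e -> factors n e.
Proof.
move=> + em; elim: n => [|n IH]; first by rewrite leqn0 => /eqP <-.
rewrite leq_eqVlt => /predU1P [<- //|]; rewrite ltnS => /IH [phi phiM ->].
exists (phi \o bond X n); first by apply: mor_comp => //; exact: bond_mor.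
by apply/funext => x /=; rewrite lproj_bond.
Qed.

Lemma cyl_ge A m (e : omega_lim X -> A) : cyl e -> exists2 n, (m <= n)%N & factors n e.
Proof.
move=> [n en]; exists (maxn m n); first exact: leq_maxl.
by apply: factors_le en; exact: leq_maxr.
Qed.

Lemma cyl_lproj n : cyl (@lproj _ _ X n).
Proof. by exists n, (fun a => a) => //; apply: mor_id; exact: level_obj. Qed.

Lemma cyl_comp B A (e : omega_lim X -> B) (g : B -> A) :
  mor F g -> cyl e -> cyl (g \o e).
Proof.
move=> gM [m [phi phiM ->]]; exists m, (g \o phi) => //; exact: mor_comp.
Qed.

Lemma cyl_obj A (e : omega_lim X -> A) : cyl e -> obj F A.
Proof. by move=> [m [phi /mor_obj []]]. Qed.

Lemma lproj_le m n (x y : omega_lim X) :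
  (m <= n)%N -> lproj n x = lproj n y -> lproj m x = lproj m y.
Proof.
elim: n => [|n IH]; first by rewrite leqn0 => /eqP ->.
rewrite leq_eqVlt => /predU1P [->|]; first exact.
rewrite ltnS => mn xy; apply: (IH mn).
by rewrite -(lproj_bond n x) -(lproj_bond n y) xy.
Qed.

Lemma bond_section n : exists s : level X n -> level X n.+1, cancel s (bond X n).
Proof.
have [_ bS _] := mor_surj (bond_mor X n).
by have [s sP] := choice bS; exists s.
Qed.

(** By induction there is a thread b through the image of a at the previous
    level; the thread x follows b up to that level, then passes through a, and
    goes on with chosen preimages. *)
Lemma lproj_surj m (a : level X m) : exists x : omega_lim X, lproj m x = a.
Proof.
pose s n : level X n -> level X n.+1 := projT1 (cid (bond_section n)).
have sK n : cancel (s n) (bond X n) by exact: projT2 (cid (bond_section n)).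
elim: m a => [|m IH] a.
  pose x := fix x n : level X n := if n is n'.+1 then s n' (x n') else a.
  by exists (@thread _ _ X x (fun n => sK n (x n))).
have [b bma] := IH (bond X m a).
pose b' := dfwith (fun n => lproj n b) m.+1 a.
pose x := fix x n : level X n :=
  if n is n'.+1 then if (n' <= m)%N then b' n'.+1 else s n' (x n') else lproj 0 b.
have xb n : (n <= m)%N -> x n = lproj n b.
  case: n => // n nm /=; rewrite ltnW // /b' dfwithout //.
  by rewrite eqSS gtn_eqF.
have xP n : bond X n (x n.+1) = x n.
  rewrite /=; case: (leqP n m) => [nm|_]; last exact: sK.
  rewrite xb //; move: nm; rewrite leq_eqVlt => /predU1P [->|nm].
    by rewrite /b' dfwithin.
  rewrite /b' dfwithout ?lproj_bond //.
  by rewrite eqSS gtn_eqF.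
exists (@thread _ _ X x xP); rewrite lproj_thread /= leqnn /b'.
exact: dfwithin.
Qed.

Lemma omega_mor_cyl (h : omega_lim X -> omega_lim X) :
  (forall n, cyl (lproj n \o h)) -> is_omega_mor h.
Proof.
move=> /choice [k kP].
pose i := fix i n := if n is n'.+1 then maxn (i n').+1 (k n) else k 0%N.
have ki n : (k n <= i n)%N by case: n => [|n] //=; exact: leq_maxr.
have ik n : factors (i n) (lproj n \o h) by exact: factors_le (ki n) (kP n).
pose phi n : level X (i n) -> level X n := projT1 (cid2 (ik n)).
exists i, phi; split.
- by apply: homo_ltn => [|n /=]; [exact: ltn_trans|exact: leq_maxl].
- by move=> n; rewrite /phi; case: cid2.
- by move=> n; rewrite /phi; case: cid2.
Qed.

Lemma cyl_omega_mor A (h : omega_lim X -> omega_lim X) (e : omega_lim X -> A) :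
  is_omega_mor h -> cyl e -> cyl (e \o h).
Proof.
move=> [i [phi [_ phiM phiE]]] [m [psi psiM ->]].
exists (i m), (psi \o phi m); first exact: mor_comp.
by rewrite -compA phiE compA.
Qed.

Hypothesis X_limit : is_fraisse_limit X.

Lemma limit_cyl A : obj F A -> exists e : omega_lim X -> A, cyl e.
Proof.
move=> oA; have [f [i [phi [_ phiM phiE]]]] := X_limit.1 A oA.
by exists (phi 0%N \o lproj (i 0%N)), (i 0%N), (phi 0%N); [exact: phiM|].
Qed.

Lemma limit_lift A B (e : omega_lim X -> A) (g : B -> A) :
  cyl e -> mor F g -> exists2 e' : omega_lim X -> B, cyl e' & g \o e' = e.
Proof.
move=> [m em] gM; have [oB oA] := mor_obj gM.
pose f (x : omega_lim X) : omega_lim (const_obj oA) :=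
  @thread _ _ (const_obj oA) (fun=> e x) (fun=> erefl).
have fM : is_omega_mor f.
  have en n : factors (m + n) e by apply: factors_le em; exact: leq_addr.
  pose phi n : level X (m + n) -> A := projT1 (cid2 (en n)).
  exists (addn m), phi; split.
  - by move=> a b; rewrite ltn_add2l.
  - by move=> n; rewrite /phi; case: cid2.
  - by move=> n; rewrite /phi; case: cid2.
have [h [i [phi [_ phiM phiE]]] hf] := X_limit.2 A B oA oB f g fM gM.
exists (phi 0%N \o lproj (i 0%N)); first by exists (i 0%N), (phi 0%N); first exact: phiM.
rewrite -phiE; apply/funext => x /=.
by have /(congr1 (lproj 0)) := congr1 (@^~ x) hf.
Qed.

End Cylinders.

Section Homogeneity.
Context {L : language} {F : proj_fraisse L} {X : omega_obj F}.
Hypothesis X_limit : is_fraisse_limit X.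

(** A stage of a back-and-forth construction of an automorphism h, to be read as
    lproj tgt (h x) = piso (lproj src x). *)
Record partial_iso := PartialIso {
  tgt : nat;
  src : nat;
  piso : level X src -> level X tgt;
  piso_mor : mor F piso }.

(** The map theta is the stage of the inverse automorphism that fits between the
    stages s and t of the automorphism. *)
Definition extends (s t : partial_iso) : Prop :=
  exists2 theta : level X (tgt t) -> level X (src s),
  mor F theta &
  [/\ (forall x : omega_lim X, piso (theta (lproj (tgt t) x)) = lproj (tgt s) x),
      (forall x : omega_lim X, theta (piso (lproj (src t) x)) = lproj (src s) x),
      (tgt s < tgt t)%N & (src s < src t)%N].

(** Lift lproj (tgt s) through piso to get theta, then lproj (src s) through
    theta to get the next stage. *)
Lemma partial_iso_extend s : exists t, extends s t.
Proof.
have [gamma gammaC gammaE] := limit_lift X_limit (cyl_lproj (tgt s)) (piso_mor s).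
have [m sm [theta thetaM thetaE]] := cyl_ge (tgt s).+1 gammaC.
have [beta betaC betaE] := limit_lift X_limit (cyl_lproj (src s)) thetaM.
have [n sn [psi psiM psiE]] := cyl_ge (src s).+1 betaC.
exists (PartialIso psiM), theta => //; split=> // x /=.
  by rewrite -gammaE thetaE.
by rewrite -betaE psiE.
Qed.

(** The threads y i x agree at higher and higher levels, so they converge. *)
Lemma glue_threads (k : nat -> nat) (y : nat -> omega_lim X -> omega_lim X) :
  (forall i, (k i < k i.+1)%N) ->
  (forall i x, lproj (k i) (y i.+1 x) = lproj (k i) (y i x)) ->
  exists h : omega_lim X -> omega_lim X,
    forall i x, lproj (k i) (h x) = lproj (k i) (y i x).
Proof.
move=> kS yS.
have ik i : (i <= k i)%N by elim: i => // i IH; exact: leq_ltn_trans IH (kS i).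
have kmono i j : (i <= j)%N -> (k i <= k j)%N.
  elim: j => [|j IH]; first by rewrite leqn0 => /eqP ->.
  by rewrite leq_eqVlt => /predU1P [->//|/IH/leq_trans]; apply; exact: ltnW.
have yij i j x : (i <= j)%N -> lproj (k i) (y j x) = lproj (k i) (y i x).
  elim: j => [|j IH]; first by rewrite leqn0 => /eqP ->.
  rewrite leq_eqVlt => /predU1P [->|]; first exact.
  by rewrite ltnS => ij; rewrite -(IH ij); apply: lproj_le (kmono _ _ ij) (yS j x).
have hP x n : bond X n (lproj n.+1 (y n.+1 x)) = lproj n (y n x).
  by rewrite lproj_bond; apply: lproj_le (ik n) (yS n x).
exists (fun x => thread (hP x)) => i x; rewrite lproj_thread.
exact: yij (ik i).
Qed.

(** The first stage psi comes from a lift of e' through the map phi that defines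
    e, so that the automorphism built from it carries e to e'. Each stage of the
    automorphism and of its inverse is realized pointwise by threads y i x and
    z i x, which are then glued. *)
Theorem limit_homogeneous (A : structure L) (e e' : omega_lim X -> A) :
  cyl e -> cyl e' -> exists h : omega_aut X, e \o h = e'.
Proof.
move=> [m [phi phiM eE]] e'C.
have [beta [n [psi psiM betaE]] e'E] := limit_lift X_limit e'C phiM.
have /choice [next nextP] := partial_iso_extend.
pose s i := iter i next (PartialIso psiM).
have sP i : extends (s i) (s i.+1) by exact: nextP.
pose theta i := s2val (cid2 (sP i)).
have thetaM i : mor F (theta i) by exact: (s2valP (cid2 (sP i))).
have [thL thR tS sS] : [/\
   forall i (x : omega_lim X), piso (theta i (lproj (tgt (s i.+1)) x)) = lproj (tgt (s i)) x,
   forall i (x : omega_lim X), theta i (piso (lproj (src (s i.+1)) x)) = lproj (src (s i)) x,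
   forall i, (tgt (s i) < tgt (s i.+1))%N &
   forall i, (src (s i) < src (s i.+1))%N].
  by split=> i; have [] := s2valP' (cid2 (sP i)).
have /choice [y yP] (i : nat) : exists y : omega_lim X -> omega_lim X,
    forall x, lproj (tgt (s i)) (y x) = piso (lproj (src (s i)) x).
  have /choice [y ?] x := lproj_surj (piso (lproj (src (s i)) x)).
  by exists y.
have /choice [z zP] (i : nat) : exists z : omega_lim X -> omega_lim X,
    forall x, lproj (src (s i)) (z x) = theta i (lproj (tgt (s i.+1)) x).
  have /choice [z ?] x := lproj_surj (theta i (lproj (tgt (s i.+1)) x)).
  by exists z.
have [|h hP] := glue_threads (k := fun i => tgt (s i)) (y := y) tS.
  by move=> i x; rewrite -thL yP thR yP.
have [|g gP] := glue_threads (k := fun i => src (s i)) (y := z) sS.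
  by move=> i x; rewrite -thR zP thL zP.
have {}hP i x : lproj (tgt (s i)) (h x) = piso (lproj (src (s i)) x) by rewrite hP.
have {}gP i x : lproj (src (s i)) (g x) = theta i (lproj (tgt (s i.+1)) x) by rewrite gP.
have lt i : (i <= tgt (s i))%N by elim: i => // i IH; exact: leq_ltn_trans IH (tS i).
have ls i : (i <= src (s i))%N by elim: i => // i IH; exact: leq_ltn_trans IH (sS i).
have gK : cancel g h.
  by move=> x; apply: lproj_inj => i; apply: lproj_le (lt i) _; rewrite hP gP thL.
have hK : cancel h g.
  by move=> x; apply: lproj_inj => i; apply: lproj_le (ls i) _; rewrite gP hP thR.
have cyl_le (j i : nat) (f : omega_lim X -> omega_lim X) : (i <= j)%N ->
    cyl (lproj j \o f) -> cyl (lproj i \o f).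
  elim: j => [|j IH]; first by rewrite leqn0 => /eqP ->.
  rewrite leq_eqVlt => /predU1P [->|]; first exact.
  rewrite ltnS => ij jf; apply: IH => //.
  rewrite (_ : _ \o _ = bond X j \o (lproj j.+1 \o f)).
    by apply: cyl_comp => //; exact: bond_mor.
  by apply/funext => x /=; rewrite lproj_bond.
have hM : is_omega_mor h.
  apply: omega_mor_cyl => i; apply: cyl_le (lt i) _; exists (src (s i)), (@piso (s i)).
    exact: piso_mor.
  by apply/funext => x; exact: hP.
have gM : is_omega_mor g.
  apply: omega_mor_cyl => i; apply: cyl_le (ls i) _; exists (tgt (s i.+1)), (theta i) => //.
  by apply/funext => x; exact: gP.
exists (OmegaAut hK gK hM gM); apply/funext => x /=.
by rewrite eE -e'E betaE /= (hP 0%N).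
Qed.

End Homogeneity.

(** * The topology of the closed subgroup *)

Section LimitTopology.
Context {R : realType} {L : language} {F : proj_fraisse L} {X : omega_obj F}.
Variable tr : ledge_transitive X.
Local Notation Q := (lim_uniform tr R).
Local Notation q := (lim_pi tr).
Local Notation G := (closure_Phi_image R tr).

Lemma lim_pi_pair_continuous :
  continuous (fun xy : omega_lim X * omega_lim X => (q xy.1, q xy.2) : Q * Q).
Proof.
have qc : continuous (q : omega_lim X -> Q) by exact: pi_continuous.
apply: (@continuous_pair _ Q Q (fun xy : omega_lim X * omega_lim X => q xy.1 : Q)
  (fun xy : omega_lim X * omega_lim X => q xy.2 : Q)) => xy.
  by apply: (@continuous_comp _ _ _ fst (q : omega_lim X -> Q)); [exact: cvg_fst|exact: qc].
by apply: (@continuous_comp _ _ _ snd (q : omega_lim X -> Q)); [exact: cvg_snd|exact: qc].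
Qed.

Lemma limit_pair_compact : compact [set: omega_lim X * omega_lim X].
Proof. by rewrite -setXTT; apply: compact_setX; exact: omega_lim_compact. Qed.

Lemma closed_lproj_rel n (P : level X n -> level X n -> Prop) :
  closed [set xy : omega_lim X * omega_lim X | P (lproj n xy.1) (lproj n xy.2)].
Proof.
rewrite -openC openE => -[x y] /= nP.
exists ([set x' | lproj n x' = lproj n x], [set y' | lproj n y' = lproj n y]).
  by split; exact: lproj_near.
by move=> [x' y'] [/= -> ->].
Qed.

(** Adjacency at level n decreases, as n grows, to the kernel of the quotient
    map, so by compactness it is eventually contained in the preimage of E. *)
Lemma entourage_level (E : set (Q * Q)) : entourage E ->
  exists n, forall m, (n <= m)%N -> forall x y : omega_lim X,
    edge (lproj m x) (lproj m y) -> E (q x, q y).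
Proof.
move=> entE; pose K n := [set xy : omega_lim X * omega_lim X |
  edge (lproj n xy.1) (lproj n xy.2)].
have decK m n : (m <= n)%N -> K n `<=` K m.
  move=> + [x y]; elim: n => [|n IH]; first by rewrite leqn0 => /eqP ->.
  rewrite leq_eqVlt => /predU1P [->|]; first exact.
  rewrite ltnS => mn xy; apply: (IH mn); rewrite /K /= -(lproj_bond n x) -(lproj_bond n y).
  by apply: morphism_edge => //; have [] := mor_surj (bond_mor X n).
pose qq (xy : omega_lim X * omega_lim X) : Q * Q := (q xy.1, q xy.2).
have [n KE] : exists n, K n `<=` (qq @^-1` E)°.
  apply: compact_nested decK _ _.
  - exact: limit_pair_compact.
  - by move=> n; exact: closed_lproj_rel.
  - exact: open_interior.
  - move=> [x y] Kxy; apply: lim_pi_pair_continuous => /=.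
    have -> : q x = q y by apply/(lim_piP tr)/ledgeE => n; exact: Kxy n.
    exact: nbhs_diag_entourage.
exists n => m nm x y mxy.
by apply: (@interior_subset _ (qq @^-1` E) (x, y)); apply: KE; exact: (decK _ _ nm (x, y) mxy).
Qed.

(** The pairs whose images under e are not adjacent form a compact set. Its image
    in the quotient is closed and misses the diagonal, because points with
    the same class have adjacent images. *)
Lemma cyl_entourage (A : structure L) (e : omega_lim X -> A) : cyl e ->
  entourage [set ab : Q * Q | forall x y : omega_lim X,
    q x = ab.1 -> q y = ab.2 -> edge (e x) (e y)].
Proof.
move=> [n [phi phiM eE]]; apply: compact_entourage; first exact: lim_uniform_compact.
move=> a; pose Z := [set xy : omega_lim X * omega_lim X | ~ edge (e xy.1) (e xy.2)].
have cZ : compact Z.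
  apply: subclosed_compact limit_pair_compact _ => //.
  have := @closed_lproj_rel n (fun a b => ~ edge (phi a) (phi b)).
  by rewrite /Z eE.
pose qq (xy : omega_lim X * omega_lim X) : Q * Q := (q xy.1, q xy.2).
have clZ : closed (qq @` Z).
  apply: compact_closed; first by apply: hausdorff_pair; exact: lim_quotient_hausdorff.
  apply: continuous_compact cZ; apply: continuous_subspaceT.
  exact: lim_pi_pair_continuous.
have : nbhs ((a, a) : Q * Q) (~` (qq @` Z)).
  apply: open_nbhs_nbhs; split; first by rewrite openC.
  move=> [[x y] /= nxy [xa ya]]; apply: nxy; rewrite eE /=.
  apply: morphism_edge; first by have [] := mor_surj phiM.
  have /(lim_piP tr)/ledgeE : q x = q y by rewrite xa ya.
  exact.
apply: filterS => -[b c] nZ x y /= xb yc; apply: contrapT => nxy.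
by apply: nZ; exists (x, y) => //; rewrite /qq /= xb yc.
Qed.

Definition Phi_closure (h : omega_aut X) : G :=
  SigSub (mem_set (subset_closure (ex_intro2 _ _ h I erefl : range (Phi R tr) (Phi R tr h)))).

Lemma Phi_closureM (h k : omega_aut X) :
  Phi_closure (h * k)%g = (Phi_closure h * Phi_closure k)%g.
Proof. by apply: val_inj; exact: PhiM. Qed.

Lemma Phi_closureV (h : omega_aut X) : Phi_closure (h^-1)%g = ((Phi_closure h)^-1)%g.
Proof. by apply: val_inj; exact: PhiV. Qed.

Lemma dense_Phi_closure : dense (range Phi_closure).
Proof.
move=> U [g Ug] [B oB BU]; rewrite -{U}BU in Ug *.
have [_ [[h _ <-] Bh]] := set_valP g B (open_nbhs_nbhs (conj oB Ug)).
by exists (Phi_closure h); split=> //; exists h.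
Qed.

Lemma nbhs1_closureP (U : set G) : nbhs (1%g : G) U <->
  exists2 E : set (Q * Q), entourage E &
    forall g : G, (forall a, E (a, (set_val g : homeo Q) a)) -> U g.
Proof.
split.
  rewrite nbhsE => -[_ [[B oB <-] B1] BU].
  have /homeo_nbhsP [E entE EB] : nbhs (1%g : HomeoF tr R) B by exact: open_nbhs_nbhs.
  by exists E => // g Eg; apply: BU; exact: EB.
move=> [E entE EU].
have nB : nbhs (1%g : HomeoF tr R) [set k : HomeoF tr R | forall a, E (a, (k : homeo Q) a)].
  by apply/homeo_nbhsP; exists E.
have c : continuous (set_val : G -> HomeoF tr R) by exact: initial_continuous.
have := c 1%g _ nB; apply: (@filterS _ (nbhs (1%g : G))) => g; exact: EU.
Qed.

Definition level_nbhs1 (n : nat) : set G := [set g | forall a : Q,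
  exists x y : omega_lim X, [/\ q x = a, q y = (set_val g : homeo Q) a &
    edge (lproj n x) (lproj n y)]].

Lemma nbhs_level_nbhs1 n : nbhs (1%g : G) (level_nbhs1 n).
Proof.
apply/nbhs1_closureP; exists [set ab : Q * Q | forall x y : omega_lim X,
    q x = ab.1 -> q y = ab.2 -> edge (lproj n x) (lproj n y)].
  exact/cyl_entourage/cyl_lproj.
move=> g gE a; have [x xa] := lim_pi_surj a.
have [y ya] := lim_pi_surj ((set_val g : homeo Q) a).
exists x, y; split=> //; exact: (gE a x y xa ya).
Qed.

Lemma level_nbhs1_base (U : set G) : nbhs (1%g : G) U ->
  exists n, forall m, (n <= m)%N -> level_nbhs1 m `<=` U.
Proof.
move=> /nbhs1_closureP [E /entourage_level [n nE] EU]; exists n => m nm g gm.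
by apply: EU => a; have [x [y [<- <- /(nE m nm)]]] := gm a.
Qed.

(** With [cyl_nbhs1], this identifies the topology of uniform convergence on
    automorphisms with closeness up to one edge at finite levels. *)
Lemma nbhs1_level (U : set G) : nbhs (1%g : G) U ->
  exists n, forall u : omega_aut X,
    (forall x, edge (lproj n (u x)) (lproj n x)) -> U (Phi_closure u).
Proof.
move=> /level_nbhs1_base [n nU]; exists n => u un; apply: (nU n (leqnn n)) => a.
have [x xa] := lim_pi_surj a; exists x, (u x); split=> //.
  by rewrite -xa; exact/esym/PhiE.
have [_ _ sym] := pf_finite_graph (level_obj X n).
exact: sym.
Qed.

Lemma cyl_nbhs1 (A : structure L) (e : omega_lim X -> A) : cyl e ->
  exists2 U : set G, nbhs (1%g : G) U & forall u : omega_aut X,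
    U (Phi_closure u) -> forall x, edge (e (u x)) (e x).
Proof.
move=> eC; exists [set g : G | forall (a : Q) x y, q x = a ->
    q y = (set_val g : homeo Q) a -> edge (e x) (e y)].
  apply/nbhs1_closureP; eexists; first exact: cyl_entourage eC.
  by move=> g gE a x y xa ya; exact: (gE a x y xa ya).
move=> u uU x; have [_ _ sym] := pf_finite_graph (cyl_obj eC).
by apply: sym; apply: (uU (q x) x (u x)) => //; exact/esym/PhiE.
Qed.

End LimitTopology.

(** * Ramsey degrees and coloring bounds *)

Section EpiDistance.
Context (R : realType) {L : language} (F : proj_fraisse L).
Implicit Types A B : structure L.

Lemma graph_dist_le1 A (a b : A) : finite_graph A ->
  (graph_dist R a b <= 1%:E)%E <-> edge a b.
Proof.
move=> [_ refl _]; split=> [|ab]; last first.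
  apply: ereal_inf_lbound; exists 1%N => //=.
  by exists (fun i => if i == 0%N then a else b); split=> // -[].
(* Lengths are integers: an infimum at most 1 yields a walk of length
   less than 2. *)
move=> /(@le_lt_trans _ _ _ _ 2%:E) ab.
have /ab /ereal_inf_lt [_ [l [p [p0 pl pe]] <-]] : (1%:E < 2%:E :> \bar R)%E.
  by rewrite lte_fin ltr1n.
rewrite lte_fin ltr_nat ltnS => l1; move: l l1 pl pe => [|[|//]] _ pl pe.
  by rewrite -p0 pl; exact: refl.
by rewrite -p0 -pl; exact: pe.
Qed.

Lemma epi_dist_le1 B A (f g : Epi F B A) :
  (epi_dist R f g <= 1%:E)%E <-> forall b, edge (f b) (g b).
Proof.
have [_ oA] := mor_obj (epi_mor f); have gA := pf_finite_graph oA.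
split=> [fg b|fg].
  apply/(graph_dist_le1 _ _ gA); apply: le_trans fg.
  by apply: ereal_sup_ubound; exists b.
by apply: ub_ereal_sup => _ [b _ <-]; apply/(graph_dist_le1 _ _ gA); exact: fg.
Qed.

End EpiDistance.

Lemma finite_approx_ramsey_degreeP (R : realType) (L : language)
    (F : struct_category L) (A : structure L) :
  finite_approx_ramsey_degree R F A <-> exists k, approx_ramsey_degree_le R F A k.
Proof.
split=> [[k [kA _]]|Ak]; first by exists k.
have exk : exists k, `[< approx_ramsey_degree_le R F A k >].
  by have [k ?] := Ak; exists k; apply/asboolP.
case: (ex_minnP exk) => k /asboolP kA kmin; exists k; split=> // j jA.
by apply: kmin; apply/asboolP.
Qed.

Section RamseyColorBound.
Context {R : realType} {L : language} {F : proj_fraisse L} {X : omega_obj F}.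
Variable tr : ledge_transitive X.
Hypothesis X_limit : is_fraisse_limit X.
Local Notation G := (closure_Phi_image R tr).
Local Notation iota := (@Phi_closure R L F X tr).

Lemma common_level (T : eqType) (A : structure L) (s : seq T)
    (e : T -> omega_lim X -> A) :
  (forall t, t \in s -> cyl (e t)) ->
  exists m, forall t, t \in s -> factors m (e t).
Proof.
elim: s => [|t s IH] es; first by exists 0%N.
have [|m ms] := IH; first by move=> t' t's; apply: es; rewrite inE t's orbT.
have [n mn tn] := cyl_ge m (es t (mem_head _ _)).
exists n => t'; rewrite inE => /predU1P [->|/ms] //.
exact: factors_le.
Qed.

Lemma range_iota_choice : exists h : G -> omega_aut X,
  forall g, range iota g -> iota (h g) = g.
Proof.
suff /choice [h hP] (g : G) : exists h, range iota g -> iota h = g by exists h.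
have [[h _ hg]|ng] := pselect (range iota g); first by exists h.
by exists 1%g => /ng.
Qed.

(** Let A be a level n such that automorphisms moving points by at most one edge
    at level n have their image in U, and let B be a level through which
    lproj n \o h factors for each h coming from E. By homogeneity each c in
    Epi(C, A) has an automorphism l c with lproj n \o l c = c \o gamma, and is
    given the color of l c. The map f in Epi(C, B) provided by the Ramsey degree
    likewise has h0 with lproj m \o h0 = f \o gamma, and h0 gives the translate. *)
Lemma ramsey_color_bound :
  (forall A, obj F A -> exists k, approx_ramsey_degree_le R F A k) ->
  forall U : set G, nbhs (1%g : G) U -> exists k, color_bound (range iota) U k.
Proof.
move=> deg U /nbhs1_level [n nU].
have [k degk] := deg (level X n) (level_obj X n).
exists k => E d chi ED.
have [h hP] := range_iota_choice.
have [a aE|m mE] := @common_level G _ E (fun a => lproj n \o h a).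
  by apply: cyl_omega_mor (cyl_lproj n); exact: aut_mor.
have [C oC CP] := degk (level X m) d (level_obj X m).
have [gamma gammaC] := limit_cyl X_limit oC.
have /choice [l lP] (c : Epi F C (level X n)) :
    exists l : omega_aut X, lproj n \o l = c \o gamma.
  apply: (limit_homogeneous X_limit (cyl_lproj n)).
  by apply: cyl_comp => //; exact: epi_mor.
have [f [J [Jk fJ]]] := CP (fun c => chi (iota (l c))).
have [h0 h0E] : exists h0 : omega_aut X, lproj m \o h0 = f \o gamma.
  apply: (limit_homogeneous X_limit (cyl_lproj m)).
  by apply: cyl_comp => //; exact: epi_mor.
exists (iota h0), J; split=> //.
move=> a aE; have [e eM eE] := mE a aE.
have [c cJ /epi_dist_le1 cd] := fJ (epi_comp (MkEpi eM) f) (ex_intro2 _ _ _ I erefl).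
pose u := (h a * h0 * (l c)^-1)%g.
exists (iota u), (iota (l c)); split=> //.
- apply: nU => x; pose z := aut_inv (l c) x.
  have [_ _ sym] := pf_finite_graph (level_obj X n); apply: sym.
  have xE : lproj n x = c (gamma z).
    have /= <- := congr1 (@^~ z) (lP c).
    by rewrite /z autVK.
  have uE : lproj n (u x) = e (f (gamma z)).
    have /= <- := congr1 (@^~ z) h0E.
    by have /= -> := congr1 (@^~ (h0 z)) eE.
  by rewrite xE uE; exact: cd.
- by rewrite -(hP a (ED a aE)) -!Phi_closureM /u mulgVK.
Qed.

End RamseyColorBound.

Fixpoint words (T : Type) (s : seq T) (n : nat) : seq (seq T) :=
  if n is n'.+1 then [seq a :: w | a <- s, w <- words s n'] else [:: [::]].

Lemma mem_words (T : eqType) (s w : seq T) :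
  (forall a, a \in w -> a \in s) -> w \in words s (size w).
Proof.
elim: w => [|a w IH] ws //=; apply/allpairsP; exists (a, w); split=> //=.
  by apply: ws; rewrite mem_head.
by apply: IH => b bw; apply: ws; rewrite inE bw orbT.
Qed.

Section ColorBoundRamsey.
Context {R : realType} {L : language} {F : proj_fraisse L} {X : omega_obj F}.
Variable tr : ledge_transitive X.
Hypothesis X_limit : is_fraisse_limit X.
Local Notation G := (closure_Phi_image R tr).
Local Notation iota := (@Phi_closure R L F X tr).

(** Every map alpha \o h factors through almost all levels, so colorings of
    Epi(level X m, A) for all m have a limit along an ultrafilter. *)
Lemma limit_coloring (A : structure L) (alpha : omega_lim X -> A) (d : nat)
    (chi : forall m, Epi F (level X m) A -> 'I_d) (h : G -> omega_aut X) :
  cyl alpha -> exists (U : set_system nat) (hatchi : G -> 'I_d),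
  [/\ ProperFilter U, \oo `<=` U & forall g, \forall m \near U,
      exists2 c : Epi F (level X m) A, alpha \o h g = c \o lproj m &
        chi m c = hatchi g].
Proof.
move=> alphaC; have [U [UU ooU]] := ultraFilterLemma (@eventually_filter).
have PU : ProperFilter U by apply: ultra_proper.
suff /choice [hatchi hatchiP] (g : G) : exists i : 'I_d, \forall m \near U,
    exists2 c : Epi F (level X m) A, alpha \o h g = c \o lproj m & chi m c = i.
  by exists U, hatchi; split.
apply: contrapT => /forallNP noi.
have : \forall m \near U, forall i, i \in enum 'I_d ->
    ~ exists2 c : Epi F (level X m) A, alpha \o h g = c \o lproj m & chi m c = i.
  apply: (@near_seq _ _ U _ (fun i m => ~ exists2 c : Epi F (level X m) A,
    alpha \o h g = c \o lproj m & chi m c = i)) => i _.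
  by have [/noi|] := in_ultra_setVsetC [set m | exists2 c : Epi F (level X m) A,
    alpha \o h g = c \o lproj m & chi m c = i] UU.
have [m0 hm0] : cyl (alpha \o h g) by apply: cyl_omega_mor alphaC; exact: aut_mor.
have : U [set m | (m0 <= m)%N] by apply: ooU; exists m0.
move=> Um0 Uno; have [m [mm0 no]] := @filter_ex _ U _ _ (filterI Um0 Uno).
have [c cM cE] := factors_le mm0 hm0.
by apply: (no (chi m (MkEpi cM))); [rewrite mem_enum | exists (MkEpi cM)].
Qed.

(** If no C works for B and d, the levels of the limit carry colorings for which
    no f in Epi(level X m, B) works. Fix beta from the limit to B, and for each e
    in Epi(B, A) an automorphism l carrying alpha to e \o beta. The bound, applied
    to the images of these automorphisms and to the limit coloring, yields h0 such
    that beta \o h0, read at a high enough level, is a map f that works. *)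
Lemma color_bound_ramsey :
  (forall U : set G, nbhs (1%g : G) U -> exists k, color_bound (range iota) U k) ->
  forall A, obj F A -> exists k, approx_ramsey_degree_le R F A k.
Proof.
move=> bound A oA; have [alpha alphaC] := limit_cyl X_limit oA.
have [U nU Ualpha] := @cyl_nbhs1 R L F X tr A alpha alphaC.
have [k kP] := bound U nU; exists k => B d oB; apply: contrapT => noC.
have bad C : obj F C -> exists chi : Epi F C A -> 'I_d, forall (f : Epi F C B) (J : {set 'I_d}),
    (#|J| <= k)%N -> ~ ([set epi_comp h f | h in [set: Epi F B A]] `<=`
      epi_nbhd1 R (chi @^-1` [set i | i \in J])).
  move=> oC; apply: contrapT => /forallNP good; apply: noC; exists C => // chi.
  have /existsNP [f /existsNP [J /not_implyP [Jk /contrapT fJ]]] := good chi.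
  by exists f, J.
pose chi m := projT1 (cid (bad _ (level_obj X m))).
have chi_bad m : forall (f : Epi F (level X m) B) (J : {set 'I_d}),
    (#|J| <= k)%N -> ~ ([set epi_comp h f | h in [set: Epi F B A]] `<=`
      epi_nbhd1 R (chi m @^-1` [set i | i \in J])).
  exact: (projT2 (cid (bad _ (level_obj X m)))).
have [h hP] := @range_iota_choice R L F X tr.
have [V [hatchi [PV ooV hatchiP]]] := limit_coloring chi h alphaC.
have [beta betaC] := limit_cyl X_limit oB.
have [/finite_seqP [sB sBE] _ _] := pf_finite_graph oB.
have [/finite_seqP [sA sAE] reflA symA] := pf_finite_graph oA.
have inB (b : B) : b \in sB by have : [set: B] b by []; rewrite sBE.
have inA (a : A) : a \in sA by have : [set: A] a by []; rewrite sAE.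
(* A map from B to A is determined by its list of values on sB, so the finite
   set Epi(B, A) is indexed by words over A. *)
have /choice [l lP] (w : seq A) : exists l : omega_aut X,
    forall e : Epi F B A, map e sB = w -> alpha \o l = e \o beta.
  have [[e0 e0w]|now] := pselect (exists e0 : Epi F B A, map e0 sB = w); last first.
    by exists 1%g => e ew; case: now; exists e.
  have [l lE] := limit_homogeneous X_limit alphaC (cyl_comp (epi_mor e0) betaC).
  exists l => e ew; rewrite lE; apply/funext => x /=.
  by have /eq_in_map := etrans e0w (esym ew); apply.
pose W := words sA (size sB).
have [a|g [J [[h0 _ <-] Jk gJ]]] := kP [seq iota (l w) | w <- W] d hatchi.
  by move=> /mapP [w _ ->]; exists (l w).
have /choice [c cP] (w : seq A) : exists c : G, w \in W ->
    hatchi c \in J /\ forall x, edge (alpha (l w (h0 x))) (alpha (h c x)).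
  have [wW|nW] := boolP (w \in W); last by exists 1%g.
  have [v [c [Uv Dc vc cJ]]] := gJ _ (map_f (fun w => iota (l w)) wW).
  exists c => _; split=> // x.
  pose u := (l w * h0 * (h c)^-1)%g.
  have uv : iota u = v.
    by rewrite /u Phi_closureM Phi_closureV hP // Phi_closureM vc mulgK.
  have := Ualpha u; rewrite uv => /(_ Uv (h c x)).
  by rewrite (_ : u (h c x) = l w (h0 x)) //= /u /= autK.
have [m0 m0P] : cyl (beta \o h0) by apply: cyl_omega_mor betaC; exact: aut_mor.
have nearW : \forall m \near V, forall w, w \in W ->
    exists2 e : Epi F (level X m) A, alpha \o h (c w) = e \o lproj m & chi m e = hatchi (c w).
  apply: (@near_seq _ _ V _ (fun w m => exists2 e : Epi F (level X m) A,
    alpha \o h (c w) = e \o lproj m & chi m e = hatchi (c w))) => w _.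
  exact: hatchiP.
have Vm0 : V [set m | (m0 <= m)%N] by apply: ooV; exists m0.
have [m [mm0 mW]] := @filter_ex _ V _ _ (filterI Vm0 nearW).
have [b bM bE] := factors_le mm0 m0P.
apply: (chi_bad m (MkEpi bM) J Jk) => _ [e _ <-].
have wW : map e sB \in W.
  by rewrite /W -(size_map e sB); apply: mem_words => a _; exact: inA.
have [c' c'E c'J] := mW _ wW; have [cJ cedge] := cP _ wW.
exists c'; first by rewrite /= c'J.
apply/epi_dist_le1 => z; have [x <-] := lproj_surj z.
have /= <- := congr1 (@^~ x) c'E.
have /= <- := congr1 (@^~ x) bE.
have /= <- := congr1 (@^~ (h0 x)) (lP _ e erefl).
by apply: symA; exact: cedge.
Qed.

End ColorBoundRamsey.

Theorem corollary5p4 (R : realType) (L : language) (F : proj_fraisse L)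
    (FF : omega_obj F) (FF_limit : is_fraisse_limit FF)
    (FF_transitive : ledge_transitive FF) :
  (forall A : structure L, obj F A -> finite_approx_ramsey_degree R F A) <->
  (exists M : flow (closure_Phi_image R FF_transitive),
     universal_minimal_flow M /\ metrizable R M).
Proof.
have [umf_bound bound_umf] := metrizable_umf_iff_color_bound R
  (@dense_Phi_closure R L F FF FF_transitive)
  (@nbhs_level_nbhs1 R L F FF FF_transitive) (@level_nbhs1_base R L F FF FF_transitive).
split=> [deg|/umf_bound bound A oA].
  apply: bound_umf.
  apply: (ramsey_color_bound FF_limit) => A /deg.
  by move/finite_approx_ramsey_degreeP.
apply/finite_approx_ramsey_degreeP.
exact: (color_bound_ramsey FF_limit bound).
Qed.
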